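(* Let $0<\alpha<\infty$ and $0<p\le\infty$, and let $k$ be any positive integer or $\infty$. Then there exists a zero sequence $Z$ for the Fock space $F^p_\alpha$ such that $\dim(I_Z)=k$ (where, for $k=\infty$, this means that $I_Z$ is infinite dimensional).
   Context: For $0<\alpha<\infty$ and $0<p<\infty$, the Fock space $F^p_\alpha$ is the space of entire functions $f$ on $\mathbb{C}$ with $\|f\|_{p,\alpha}^p=\frac{\alpha}{\pi}\int_{\mathbb{C}}\left|f(z)e^{-\frac{\alpha}{2}|z|^2}\right|^p\,dA(z)<\infty$, where $dA$ is Lebesgue area measure. For $p=\infty$, $F^\infty_\alpha$ is the space of entire functions $f$ with $\|f\|_{\infty,\alpha}=\sup_{z\in\mathbb{C}}|f(z)|e^{-\frac{\alpha}{2}|z|^2}<\infty$. Sequences in $\mathbb{C}$ are countable (possibly finite) and are treated as multisets: points may be repeated, and the number of repetitions of a point is its multiplicity. A function $f$ vanishes on $Z$ if at each point of $Z$ it has a zero of order at least the multiplicity of that point in $Z$ (additional zeros are permitted). A sequence $Z$ is a zero sequence for $F^p_\alpha$ if there is $f\in F^p_\alpha$, not identically zero, whose zeros, counted with multiplicity, are exactly $Z$. $I_Z$ denotes the vector space of all $f\in F^p_\alpha$ that vanish on $Z$; $\dim$ is the complex dimension. *)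

(* Defs.v *)
From mathcomp Require Import all_boot all_order all_algebra.
From mathcomp Require Import all_classical all_reals all_analysis.
From mathcomp Require Import complex.

Set Implicit Arguments.
Unset Strict Implicit.
Unset Printing Implicit Defensive.

Import Order.TTheory GRing.Theory Num.Theory.
Import numFieldNormedType.Exports.

Local Open Scope classical_set_scope.
Local Open Scope card_scope.
Local Open Scope ring_scope.

Section Fock.
Variable R : realType.
Local Notation C := (R[i]).

(* [R[i]^o] is R[i] as a normed module over itself, so the scalars of the
   difference quotient are complex: this is complex differentiability. *)
Definition entire (f : C -> C) : Prop :=
  forall z : C, derivable (f : C^o -> C^o) z 1.

(* The R-valued modulus; the norm `|z| of R[i] is R[i]-valued. *)
Definition cmod (z : C) : R := Normc.normc z.

Local Notation area_measure := (@lebesgue_measure R \x @lebesgue_measure R)%E.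

Definition weighted (alpha : R) (f : C -> C) (z : C) : R :=
  cmod (f z) * expR (- (alpha / 2) * cmod z ^+ 2).

(* The space F^p_alpha for 0 < p <= +oo.  For finite p the condition is the
   finiteness of the p-th power of the norm.  The value at p = -oo is junk. *)
Definition fock_space (p : \bar R) (alpha : R) : set (C -> C) :=
  [set f | entire f /\
    match p with
    | r%:E => ((alpha / pi)%:E *
        \int[area_measure]_w (weighted alpha f (w.1 +i* w.2)%C `^ r)%:E
          < +oo)%E
    | +oo%E => (ereal_sup [set (weighted alpha f z)%:E | z in [set: C]] < +oo)%E
    | -oo%E => False
    end].

(* A countable, possibly finite, sequence of points: the points are the values
   [Some a].  Their order and the positions of the [None]s are irrelevant:
   only the multiplicities, i.e. the cardinals of [occ Z a], are used. *)
Definition point_seq := nat -> option C.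

Definition occ (Z : point_seq) (a : C) : set nat := [set n | Z n = Some a].

Definition zero_order_ge (f : C -> C) (a : C) (m : nat) : Prop :=
  exists2 g : C -> C, entire g & forall z, f z = (z - a) ^+ m * g z.

(* With m = 0 this says that a is not a zero of f. *)
Definition zero_order (f : C -> C) (a : C) (m : nat) : Prop :=
  exists g : C -> C,
    [/\ entire g, g a != 0 & forall z, f z = (z - a) ^+ m * g z].

(* A point of infinite multiplicity forces a zero of every order. *)
Definition vanishes_on (f : C -> C) (Z : point_seq) : Prop :=
  forall (a : C) (m : nat), `I_m #<= occ Z a -> zero_order_ge f a m.

Definition zeros_exactly (f : C -> C) (Z : point_seq) : Prop :=
  forall a : C, exists2 m : nat, occ Z a #= `I_m & zero_order f a m.

Definition zero_sequence (p : \bar R) (alpha : R) (Z : point_seq) : Prop :=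
  exists f : C -> C,
    [/\ fock_space p alpha f, exists z, f z != 0 & zeros_exactly f Z].

Definition vanishing_space (p : \bar R) (alpha : R) (Z : point_seq) : set (C -> C) :=
  [set f | fock_space p alpha f /\ vanishes_on f Z].

Definition lin_indep (n : nat) (b : 'I_n -> C -> C) : Prop :=
  forall c : 'I_n -> C,
    (forall z, \sum_(i < n) c i * b i z = 0) -> forall i, c i = 0.

Definition spans (n : nat) (b : 'I_n -> C -> C) (V : set (C -> C)) : Prop :=
  forall f, V f -> exists c : 'I_n -> C,
    forall z, f z = \sum_(i < n) c i * b i z.

Definition has_basis (V : set (C -> C)) (n : nat) : Prop :=
  exists b : 'I_n -> C -> C,
    [/\ forall i, V (b i), lin_indep b & spans b V].

(* Complex dimension of a linear subspace V; [None] stands for infinity. *)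
Definition dim_is (V : set (C -> C)) (k : option nat) : Prop :=
  match k with
  | Some n => has_basis V n
  | None => forall n, ~ has_basis V n
  end.

End Fock.

(* Main.v *)
Require Import Defs.
From mathcomp Require Import all_boot all_order all_algebra.
From mathcomp Require Import all_classical all_reals all_analysis.
From mathcomp Require Import complex.
From mathcomp Require Import measurable_realfun ring lra zify.

(** The space [F^p] is compared with a single entire function [P] that is, up to
polynomial factors, as large as the weight allows on a sequence of circles with
radii tending to infinity: a lacunary power series whose terms are monomials
tangent to [exp (alpha |z|^2 / 2)] ([lacunary_exists]).  Its parameters are chosen
so that [P, z P, ..., z^k P] are all in [F^p] ([fock_of_decay]).

Functions in [F^p] satisfy [|f z| <= K (1 + |z|)^n exp (alpha |z|^2 / 2)]
([fock_pointwise]).  Hence [z^j P] is not in [F^p] for large [j]; let [J] be the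
first such [j], put [a = J - k], and let [Z] be the zero sequence of [z^a P].  If
[f] in [F^p] vanishes on [Z], then [f = q z^a P] with [q] entire
([entire_quotient]).  On the good circles [q] is at most polynomially large, so it
is a polynomial ([entire_poly]), and comparing [f] with [z^J P] shows that its
degree is less than [k] ([fock_dominated]).  So [z^a P, ..., z^(J-1) P] is a basis
of [I_Z] ([finite_dim]).  For infinite dimension the empty sequence works: it is
the zero sequence of the constant 1, and [F^p] contains all polynomials
([fock_infinite_dim]).

All of this needs Taylor expansions of functions that are merely complex
differentiable at every point.  Goursat's theorem for a rectangle ([goursat]),
applied in the logarithmic coordinate, shows that the mean over a circle centred
at 0 does not depend on its radius where the function is holomorphic
([circ_const]).  Applied to the difference quotient of [f] at a point, this is
Cauchy's formula, and the geometric series turns it into the Taylor expansion with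
Cauchy's estimates ([taylor], [tcoef_le]).  Liouville's theorem for polynomial
growth, the factorisation of zeros, and the enumeration of the zero set are then
statements about power series. *)

Set Implicit Arguments.
Unset Strict Implicit.
Unset Printing Implicit Defensive.

Import Order.TTheory GRing.Theory Num.Theory.
Import numFieldNormedType.Exports.

Local Open Scope classical_set_scope.
Local Open Scope ring_scope.

Local Notation Re := (@complex.Re _).
Local Notation Im := (@complex.Im _).

#[local] Arguments cmod : simpl never.

(** * The complex modulus *)

Section Modulus.
Variable R : realType.
Local Notation C := (R[i]).
Implicit Types (x y z : C).

Lemma normCE z : `|z| = (cmod z)%:C%C. Proof. by []. Qed.

Lemma cmod_ge0 z : 0 <= cmod z.
Proof. by case: z => a b; apply: sqrtr_ge0. Qed.
Lemma cmodM x y : cmod (x * y) = cmod x * cmod y.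
Proof. exact: Normc.normcM. Qed.
Lemma cmodD x y : cmod (x + y) <= cmod x + cmod y.
Proof. exact: le_normcD. Qed.
Lemma cmodN x : cmod (- x) = cmod x.
Proof. exact: normcN. Qed.
Lemma cmodB x y : cmod (x - y) <= cmod x + cmod y.
Proof. by rewrite -(cmodN y) cmodD. Qed.
Lemma cmod_subC x y : cmod (x - y) = cmod (y - x).
Proof. by rewrite -cmodN opprB. Qed.
Lemma cmod_subl x y : cmod x - cmod y <= cmod (x - y).
Proof. by rewrite lerBlDr (le_trans _ (cmodD _ _)) // subrK. Qed.
Lemma cmod_dist x y : `|cmod x - cmod y| <= cmod (x - y).
Proof. by rewrite ler_norml cmod_subl andbT lerNl opprB cmod_subC cmod_subl. Qed.
Lemma cmodV x : cmod x^-1 = (cmod x)^-1.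
Proof. exact: Normc.normcV. Qed.
Lemma cmod0 : cmod (0 : C) = 0. Proof. exact: Normc.normc0. Qed.
Lemma cmod1 : cmod (1 : C) = 1. Proof. exact: Normc.normc1. Qed.
Lemma cmodX x n : cmod (x ^+ n) = cmod x ^+ n.
Proof. by elim: n => [|n IH]; rewrite ?expr0 ?cmod1 // !exprS cmodM IH. Qed.
Lemma cmod_eq0 x : (cmod x == 0) = (x == 0).
Proof.
by apply/eqP/eqP => [/Normc.eq0_normc //|->]; exact: cmod0.
Qed.
Lemma cmod_gt0 x : (0 < cmod x) = (x != 0).
Proof. by rewrite lt0r cmod_eq0 cmod_ge0 andbT. Qed.
Lemma cmod_sum (I : Type) (r : seq I) (P : pred I) (F : I -> C) :
  cmod (\sum_(i <- r | P i) F i) <= \sum_(i <- r | P i) cmod (F i).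
Proof.
elim/big_rec2: _ => [|i y x _ IH]; first by rewrite cmod0.
by apply: le_trans (cmodD _ _) _; rewrite lerD2l.
Qed.
Lemma cmodE z : cmod z = Num.sqrt (Re z ^+ 2 + (Im z) ^+ 2).
Proof. by case: z. Qed.
Lemma cmod_sqr z : cmod z ^+ 2 = (Re z) ^+ 2 + (Im z) ^+ 2.
Proof. by rewrite cmodE sqr_sqrtr // addr_ge0 ?sqr_ge0. Qed.
Lemma Re_le_cmod z : `|Re z| <= cmod z.
Proof.
rewrite -(ler_pXn2r (n := 2)) ?nnegrE ?cmod_ge0 // cmod_sqr real_normK ?num_real //.
by rewrite lerDl sqr_ge0.
Qed.
Lemma Im_le_cmod z : `|Im z| <= cmod z.
Proof.
rewrite -(ler_pXn2r (n := 2)) ?nnegrE ?cmod_ge0 // cmod_sqr real_normK ?num_real //.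
by rewrite lerDr sqr_ge0.
Qed.
Lemma cmod_le_ReIm z : cmod z <= `|Re z| + `|Im z|.
Proof.
rewrite -(ler_pXn2r (n := 2)) ?nnegrE ?cmod_ge0 ?addr_ge0 // cmod_sqr.
rewrite sqrrD !real_normK ?num_real // lerD2r lerDl.
by rewrite pmulrn_lge0 // mulr_ge0.
Qed.
Lemma cmod_real (r : R) : cmod (r%:C)%C = `|r|.
Proof. by rewrite cmodE /= expr0n /= addr0 sqrtr_sqr. Qed.
Lemma cmod_nat n : cmod (n%:R : C) = n%:R.
Proof. by rewrite -(rmorph_nat (real_complex R)) cmod_real normr_nat. Qed.
Lemma cmodi : cmod ('i%C : C) = 1.
Proof. by rewrite cmodE /= expr0n /= add0r expr1n sqrtr1. Qed.
Lemma ReD x y : Re (x + y) = Re x + Re y.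
Proof. by case: x => a b; case: y. Qed.
Lemma ImD x y : Im (x + y) = Im x + Im y.
Proof. by case: x => a b; case: y. Qed.
Lemma ReM x y : Re (x * y) = Re x * Re y - Im x * Im y.
Proof. by case: x => a b; case: y. Qed.
Lemma ImM x y : Im (x * y) = Re x * Im y + Im x * Re y.
Proof. by case: x => a b; case: y. Qed.
Lemma ReN x : Re (- x) = - Re x. Proof. by case: x. Qed.
Lemma ImN x : Im (- x) = - Im x. Proof. by case: x. Qed.
Lemma eq_ReIm x y : Re x = Re y -> Im x = Im y -> x = y.
Proof. by case: x => a b; case: y => c d /= -> ->. Qed.

End Modulus.

(** * Complex differentiability *)

Section Differentiability.
Variable R : realType.
Local Notation C := (R[i]).
Implicit Types (f g : C -> C) (z : C).

(** The norm of [R[i]] takes its values in [R[i]]; this form of continuity keeps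
all estimates in [R]. *)
Definition ccont f z := forall e : R, 0 < e -> exists2 d : R, 0 < d &
  forall w, cmod (w - z) < d -> cmod (f w - f z) < e.

Lemma ccontP f z : ccont f z <-> {for z, continuous (f : C^o -> C^o)}.
Proof.
split.
  move=> H; apply/(@cvgrPdist_lt C C^o _ (nbhs (z : C^o))) => -[e e']; rewrite ltcE /= => /andP[/eqP -> e0].
  have [d d0 Hd] := H _ e0.
  apply/(@nbhs_ballP C C^o); exists (d%:C)%C; rewrite /= ?ltcR // => w.
  rewrite /ball /= => wz; rewrite distrC; apply/(_ : is_true (_ < (e%:C)%C)).
  by rewrite normCE ltcR Hd // cmod_subC -ltcR.
move=> /(@cvgrPdist_lt C C^o _ (nbhs (z : C^o))) H e e0.
have /(@nbhs_ballP C C^o) : \forall t \near (z : C^o), `|f z - f t| < (e%:C)%C.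
  by apply: H; rewrite ltcR.
move=> [[d d']]; rewrite /= ltcE /= => /andP[/eqP -> d0] Hd.
exists d => // w wz; have := Hd w; rewrite /ball /=.
have -> : `|z - w| < (d%:C)%C by rewrite normCE ltcR cmod_subC.
by move=> /(_ isT); rewrite normCE ltcR cmod_subC.
Qed.

Lemma ccont_cst (c : C) z : ccont (fun=> c) z.
Proof. by move=> e e0; exists 1 => // w _; rewrite subrr cmod0. Qed.

Lemma ccont_id z : ccont id z.
Proof. by move=> e e0; exists e. Qed.

Lemma ccontD f g z : ccont f z -> ccont g z -> ccont (fun w => f w + g w) z.
Proof.
move=> /ccontP cf /ccontP cg; apply/ccontP.
exact: (@cvgD C C^o _ (nbhs (z : C^o)) _ f g _ _ cf cg).
Qed.

Lemma ccontM f g z : ccont f z -> ccont g z -> ccont (fun w => f w * g w) z.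
Proof.
move=> /ccontP cf /ccontP cg; apply/ccontP.
exact: (@cvgM C _ (nbhs (z : C^o)) _ f g _ _ cf cg).
Qed.

Lemma ccont_comp f g z : ccont g z -> ccont f (g z) -> ccont (f \o g) z.
Proof.
move=> cg cf e /cf[d /cg[d' d'0 Hg] Hf]; exists d' => // w /Hg; exact: Hf.
Qed.

Lemma ccontB f g z : ccont f z -> ccont g z -> ccont (fun w => f w - g w) z.
Proof.
move=> cf cg; have := ccontD cf (ccontM (ccont_cst (-1) z) cg).
by congr ccont; apply/funext => w; rewrite mulN1r.
Qed.

(** Caratheodory's form of complex differentiability: the difference quotient
extends continuously to [z].  It turns the chain and product rules into
continuity statements. *)
Definition cdiff f z := exists2 q : C -> C, ccont q z &
  forall w, f w = f z + q w * (w - z).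

Lemma cdiff_ccont f z : cdiff f z -> ccont f z.
Proof.
move=> [q qz fE].
rewrite (_ : f = (fun w => f z + q w * (w - z))); last exact/funext.
apply: ccontD; first exact: ccont_cst.
by apply: ccontM => //; apply: ccontB; [exact: ccont_id|exact: ccont_cst].
Qed.

(** The quotient provided by a derivative is given its missing value at [z];
conversely the derivative is the value of the quotient at [z]. *)
Lemma cdiffP f z : cdiff f z <-> derivable (f : C^o -> C^o) z 1.
Proof.
split.
  move=> [q qz fE]; rewrite /derivable.
  apply/cvg_ex; exists (q z).
  apply/(@cvgrPdist_lt C C^o) => e e0; near=> h.
  have h0 : h != 0 by near: h; exact: nbhs_dnbhs_neq.
  have -> : h^-1 *: ((f \o shift z) (h *: (1 : C^o)) - f z) = q (h + z).
    by rewrite /= /shift /= /GRing.scale /= mulr1 (fE (h + z)) addrK addrAC subrr add0r mulrC mulfK.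
  near: h; apply: cvg_within.
  have /ccontP/(@cvgrPdist_lt C C^o _ (nbhs (0 : C^o))) : ccont (fun h => q (h + z)) 0.
    apply: (@ccont_comp q (fun h => h + z)); last by rewrite add0r.
    by apply: ccontD; [exact: ccont_id|exact: ccont_cst].
  by move=> /(_ _ e0); rewrite add0r.
move=> /cvg_ex [D /(@cvgrPdist_lt C C^o) HD].
exists (fun w => if w == z then D else (f w - f z) / (w - z)); last first.
  move=> w; case: eqP => [->|/eqP wz]; first by rewrite subrr mulr0 addr0.
  by rewrite mulfVK ?subr_eq0 // addrC subrK.
move=> e e0.
have /HD : (0 < e%:C%C :> C) by rewrite ltcR.
move=> /(@nbhs_ballP C C^o)[[d d']]; rewrite /= ltcE /= => /andP[/eqP -> d0] Hd.
exists d => // w wz; rewrite eqxx; have [_|wz0] := eqVneq w z; first by rewrite subrr cmod0.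
have := Hd (w - z); rewrite /ball /= sub0r normrN normCE ltcR wz.
move=> /(_ isT); rewrite subr_eq0 => /(_ wz0).
by rewrite /GRing.scale /= mulr1 subrK distrC mulrC normCE ltcR.
Unshelve. all: by end_near.
Qed.

Lemma entireP f : entire f <-> forall z, cdiff f z.
Proof. by split=> H z; apply/cdiffP. Qed.

Lemma cdiff_comp f g z : cdiff g z -> cdiff f (g z) -> cdiff (f \o g) z.
Proof.
move=> dg; have cg := cdiff_ccont dg; case: dg => [q qz gE] [p pz fE].
exists (fun w => p (g w) * q w).
  by apply: ccontM => //; exact: (@ccont_comp p g).
move=> w /=; rewrite fE; congr (_ + _); rewrite -mulrA; congr (_ * _).
by rewrite (gE w) addrAC subrr add0r.
Qed.

Lemma cdiff_cst (c : C) z : cdiff (fun=> c) z.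
Proof. by exists (fun=> 0); [move=> e e0; exists 1 => // w _; rewrite subrr cmod0|move=> w; rewrite mul0r addr0]. Qed.

Lemma cdiff_id z : cdiff id z.
Proof. by exists (fun=> 1); [move=> e e0; exists 1 => // w _; rewrite subrr cmod0|move=> w; rewrite mul1r addrC subrK]. Qed.

Lemma cdiffD f g z : cdiff f z -> cdiff g z -> cdiff (fun w => f w + g w) z.
Proof.
move=> [q qz fE] [p pz gE]; exists (fun w => q w + p w); first exact: ccontD.
by move=> w; rewrite fE gE; ring.
Qed.

Lemma cdiffM f g z : cdiff f z -> cdiff g z -> cdiff (fun w => f w * g w) z.
Proof.
move=> df dg; have cg := cdiff_ccont dg; case: df dg => [q qz fE] [p pz gE].
exists (fun w => q w * g w + f z * p w).
  by apply: ccontD; apply: ccontM => //; exact: ccont_cst.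
by move=> w; rewrite fE (gE w); ring.
Qed.

Lemma cdiffN f z : cdiff f z -> cdiff (fun w => - f w) z.
Proof.
move=> df; have := cdiffM (cdiff_cst (-1) z) df.
by congr cdiff; apply/funext => w; rewrite mulN1r.
Qed.

Lemma cdiffB f g z : cdiff f z -> cdiff g z -> cdiff (fun w => f w - g w) z.
Proof. by move=> df dg; apply: cdiffD => //; exact: cdiffN. Qed.

Lemma cdiffV f z : f z != 0 -> cdiff f z -> cdiff (fun w => (f w)^-1) z.
Proof.
by move=> f0 /cdiffP df; apply/cdiffP; exact: (@derivableV C C^o f z 1 f0 df).
Qed.

Lemma cdiffX f n z : cdiff f z -> cdiff (fun w => f w ^+ n) z.
Proof.
move=> df; elim: n => [|n IH].
  by under eq_fun do rewrite expr0; exact: cdiff_cst.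
by under eq_fun do rewrite exprS; exact: cdiffM.
Qed.

Lemma cdiff_local f g z (d : R) : 0 < d ->
  (forall w, cmod (w - z) < d -> f w = g w) -> cdiff f z -> cdiff g z.
Proof.
move=> d0 fg [q qz fE].
exists (fun w => if w == z then q z else (g w - g z) / (w - z)); last first.
  move=> w; case: eqP => [->|/eqP wz]; first by rewrite subrr mulr0 addr0.
  by rewrite mulfVK ?subr_eq0 // addrC subrK.
move=> e e0; have [d' d'0 H] := qz e e0.
exists (Num.min d d'); first by rewrite lt_min d0.
move=> w; rewrite lt_min => /andP[wd wd']; rewrite eqxx; have [_|wz] := eqVneq w z.
  by rewrite subrr cmod0.
rewrite -fg // -fg ?subrr ?cmod0 //.
by rewrite fE addrAC subrr add0r mulfK ?subr_eq0 // H.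
Qed.

End Differentiability.

(** * Integrals of complex functions of a real variable *)

Section RealIntegral.
Variable R : realType.
Notation mu := (@lebesgue_measure R).
Implicit Types (u v : R -> R) (a b c : R).

Definition rint u a b : R := (\int[mu]_(x in `[a, b]) u x)%R.

Lemma continuous_integrable u {a b} : continuous u ->
  mu.-integrable `[a, b] (EFin \o u).
Proof.
move=> cu; apply: continuous_compact_integrable; first exact: segment_compact.
exact: continuous_subspaceT.
Qed.

Lemma rint_cat u a b c : continuous u -> a <= b -> b <= c ->
  rint u a c = rint u a b + rint u b c.
Proof.
move=> cu ab bc; apply/eqP; rewrite addrC -subr_eq; apply/eqP.
rewrite /rint (Rintegral_itvB (continuous_integrable cu)) ?bnd_simp //.
rewrite Rintegral_itv_obnd_cbnd //.
apply: integrableS (continuous_integrable (a := b) (b := c) cu) => //.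
exact: subset_itv_oc_cc.
Qed.

Lemma rintD u v a b : continuous u -> continuous v ->
  rint (fun x => u x + v x) a b = rint u a b + rint v a b.
Proof. by move=> cu cv; apply: RintegralD => //; exact: continuous_integrable. Qed.

Lemma rintZ k u a b : continuous u -> rint (fun x => k * u x) a b = k * rint u a b.
Proof. by move=> cu; apply: RintegralZl => //; exact: continuous_integrable. Qed.

Lemma rint_le u a b (M : R) : continuous u -> a <= b ->
  (forall x, a <= x <= b -> `|u x| <= M) -> `|rint u a b| <= M * (b - a).
Proof.
move=> cu ab uM.
apply: (le_trans (le_normr_Rintegral _ (continuous_integrable cu))) => //.
have <- : \int[mu]_(x in `[a, b]) M = M * (b - a).
  rewrite Rintegral_cst //; congr (_ * _).
  have := lebesgue_measure_itv `[a, b] => /= ->.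
  by rewrite lte_fin; move: ab; rewrite le_eqVlt => /orP[/eqP ->|->]; rewrite ?ltxx ?subrr.
apply: le_Rintegral => //.
- apply: (@continuous_integrable (fun x => `|u x|)) => x.
  by apply: cvg_norm; exact: cu.
- exact: (@continuous_integrable (fun=> M) _ _ (@cst_continuous _ _ M)).
Qed.

Lemma rint_FTC u (U : R -> R) a b : continuous u -> a <= b ->
  (forall x : R, is_derive x (1 : R) U (u x)) -> rint u a b = U b - U a.
Proof.
move=> cu; rewrite le_eqVlt => /orP[/eqP <- _|ab dU].
  by rewrite /rint set_itv1 Rintegral_set1 subrr.
have cU x : {for x, continuous U}.
  apply: differentiable_continuous; apply/derivable1_diffP; exact: ex_derive.
rewrite /rint /Rintegral (@continuous_FTC2 _ u U) //.
- exact: continuous_subspaceT.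
- split; first by move=> x _; exact: ex_derive.
  + by apply: cvg_at_right_filter; exact: cU.
  + by apply: cvg_at_left_filter; exact: cU.
- by move=> x _; rewrite derive1E; exact: derive_val.
Qed.

End RealIntegral.

Section ComplexIntegral.
Variable R : realType.
Local Notation C := (R[i]).
Implicit Types (u v : R -> C) (a b c : R).

(** Continuity of a path in [C], with real bounds as in [ccont]. *)
Definition rcont u := forall x (e : R), 0 < e -> exists2 d : R, 0 < d &
  forall y, `|y - x| < d -> cmod (u y - u x) < e.

Lemma rcont_Re u : rcont u -> continuous (fun x => Re (u x)).
Proof.
move=> cu x; apply/cvgrPdist_lt => e e0; have [d d0 H] := cu x e e0.
apply/nbhs_ballP; exists d => //= y; rewrite /ball /= distrC => /H yx.
by rewrite distrC -ReN -ReD (le_lt_trans (Re_le_cmod _)).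
Qed.

Lemma rcont_Im u : rcont u -> continuous (fun x => Im (u x)).
Proof.
move=> cu x; apply/cvgrPdist_lt => e e0; have [d d0 H] := cu x e e0.
apply/nbhs_ballP; exists d => //= y; rewrite /ball /= distrC => /H yx.
by rewrite distrC -ImN -ImD (le_lt_trans (Im_le_cmod _)).
Qed.

Lemma rcont_ReIm u : continuous (fun x => Re (u x)) ->
  continuous (fun x => Im (u x)) -> rcont u.
Proof.
move=> cr ci x e e0; have e2 : 0 < e / 2 by rewrite divr_gt0.
have /cvgrPdist_lt/(_ _ e2)/nbhs_ballP[d1 /= d10 H1] := cr x.
have /cvgrPdist_lt/(_ _ e2)/nbhs_ballP[d2 /= d20 H2] := ci x.
exists (Num.min d1 d2); first by rewrite lt_min d10.
move=> y; rewrite lt_min distrC => /andP[/H1 h1 /H2 h2].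
rewrite cmod_subC (le_lt_trans (cmod_le_ReIm _)) // ReD ImD ReN ImN.
by rewrite (splitr e) ltrD.
Qed.

Lemma rcont_cst (k : C) : rcont (fun=> k).
Proof. by move=> x e e0; exists 1 => // y _; rewrite subrr cmod0. Qed.

Lemma rcont_comp u (f : C -> C) : rcont u -> (forall x, ccont f (u x)) ->
  rcont (fun x => f (u x)).
Proof.
move=> cu cf x e e0; have [d d0 Hf] := cf x e e0.
by have [d' d'0 Hu] := cu x d d0; exists d' => // y /Hu; exact: Hf.
Qed.

Lemma rcontD u v : rcont u -> rcont v -> rcont (fun x => u x + v x).
Proof.
move=> cu cv x e e0; have e2 : 0 < e / 2 by rewrite divr_gt0.
have [d1 d10 H1] := cu x _ e2; have [d2 d20 H2] := cv x _ e2.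
exists (Num.min d1 d2); first by rewrite lt_min d10.
move=> y; rewrite lt_min => /andP[/H1 h1 /H2 h2].
by rewrite opprD addrACA (le_lt_trans (cmodD _ _)) // (splitr e) ltrD.
Qed.

Lemma rcontZ (k : C) u : rcont u -> rcont (fun x => k * u x).
Proof.
move=> cu; apply: (@rcont_comp u (fun z => k * z)) => // x.
by apply: ccontM; [exact: ccont_cst|exact: ccont_id].
Qed.

Definition cint u a b : C := Complex (rint (fun x => Re (u x)) a b) (rint (fun x => Im (u x)) a b).

Lemma cint_cat u a b c : rcont u -> a <= b -> b <= c ->
  cint u a c = cint u a b + cint u b c.
Proof.
move=> cu ab bc; apply: eq_ReIm; rewrite ?ReD ?ImD /=.
  by apply: rint_cat => //; exact: rcont_Re.
by apply: rint_cat => //; exact: rcont_Im.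
Qed.

Lemma cintD u v a b : rcont u -> rcont v ->
  cint (fun x => u x + v x) a b = cint u a b + cint v a b.
Proof.
move=> cu cv; apply: eq_ReIm; rewrite ?ReD ?ImD /=.
  rewrite -rintD; [|exact: rcont_Re..].
  by congr rint; apply/funext => x; rewrite ReD.
rewrite -rintD; [|exact: rcont_Im..].
by congr rint; apply/funext => x; rewrite ImD.
Qed.

Lemma cintZ (k : C) u a b : rcont u -> cint (fun x => k * u x) a b = k * cint u a b.
Proof.
move=> cu; have cr := rcont_Re cu; have ci := rcont_Im cu.
have crZ (l : R) (f : R -> R) : continuous f -> continuous (fun x => l * f x).
  by move=> cf x; apply: cvgM; [exact: cvg_cst|exact: cf].
apply: eq_ReIm; rewrite ?ReM ?ImM /=.
  rewrite -rintZ // -mulNr -rintZ // -rintD; [|exact: crZ..].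
  by congr rint; apply/funext => x; rewrite ReM mulNr.
rewrite -rintZ // -rintZ // -rintD; [|exact: crZ..].
by congr rint; apply/funext => x; rewrite ImM.
Qed.

Lemma cintB u v a b : rcont u -> rcont v ->
  cint (fun x => u x - v x) a b = cint u a b - cint v a b.
Proof.
move=> cu cv; rewrite -mulN1r -cintZ // -cintD //; last exact: rcontZ.
by congr cint; apply/funext => x; rewrite mulN1r.
Qed.

(** The factor 2 pays for estimating real and imaginary parts separately; no
later constant is sharp, so it is harmless. *)
Lemma cint_le u a b (M : R) : rcont u -> a <= b ->
  (forall x, a <= x <= b -> cmod (u x) <= M) -> cmod (cint u a b) <= 2 * M * (b - a).
Proof.
move=> cu ab uM; rewrite (le_trans (cmod_le_ReIm _)) //= -mulrA mulr_natl mulr2n lerD //.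
  apply: rint_le => //; first exact: rcont_Re.
  by move=> x xab; rewrite (le_trans (Re_le_cmod _)) // uM.
apply: rint_le => //; first exact: rcont_Im.
by move=> x xab; rewrite (le_trans (Im_le_cmod _)) // uM.
Qed.

Lemma cint_FTC u (U : R -> C) a b : rcont u -> a <= b ->
  (forall x : R, is_derive x (1 : R) (fun x => Re (U x)) (Re (u x))) ->
  (forall x : R, is_derive x (1 : R) (fun x => Im (U x)) (Im (u x))) ->
  cint u a b = U b - U a.
Proof.
move=> cu ab dr di; apply: eq_ReIm; rewrite ?ReD ?ImD ?ReN ?ImN /=.
  by rewrite (rint_FTC _ _ dr) //; exact: rcont_Re.
by rewrite (rint_FTC _ _ di) //; exact: rcont_Im.
Qed.

Lemma eq_cint u v a b : (forall x, a <= x <= b -> u x = v x) -> cint u a b = cint v a b.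
Proof.
by move=> uv; congr Complex; apply: eq_Rintegral => x; rewrite inE /= in_itv /= => /uv ->.
Qed.

Lemma cint_cst (k : C) a b : a <= b -> cint (fun=> k) a b = k * ((b - a)%:C)%C.
Proof.
move=> ab.
have dr (x : R) : is_derive x (1 : R) (fun x => Re (k * (x%:C)%C)) (Re k).
  rewrite (_ : (fun x => _) = (fun x => Re k * x)); last first.
    by apply/funext => y; rewrite ReM /= mulr0 subr0.
  by apply: is_derive_eq; rewrite /GRing.scale /= mulr1.
have di (x : R) : is_derive x (1 : R) (fun x => Im (k * (x%:C)%C)) (Im k).
  rewrite (_ : (fun x => _) = (fun x => Im k * x)); last first.
    by apply/funext => y; rewrite ImM /= mulr0 add0r.
  by apply: is_derive_eq; rewrite /GRing.scale /= mulr1.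
by rewrite (@cint_FTC _ _ a b (@rcont_cst k) ab dr di) -mulrBr rmorphB.
Qed.

End ComplexIntegral.

(** * Goursat's theorem on rectangles *)

Section Goursat.
Variable R : realType.
Local Notation C := (R[i]).
Implicit Types (h : C -> C) (x y l m : R).

Lemma rcont_hline y : rcont (fun t : R => Complex t y).
Proof.
move=> x e e0; exists e => // t tx.
by rewrite (le_lt_trans (cmod_le_ReIm _)) //= subrr normr0 addr0.
Qed.

Lemma rcont_vline x : rcont (fun t : R => Complex x t).
Proof.
move=> y e e0; exists e => // t ty.
by rewrite (le_lt_trans (cmod_le_ReIm _)) //= subrr normr0 add0r.
Qed.

(** The contour integral, counterclockwise from the lower left corner, around the
rectangle with that corner at [(x, y)] and sides [l], [m]. *)
Definition rect_int h x y l m : C :=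
  cint (fun t => h (Complex t y)) x (x + l)
  + 'i%C * cint (fun t => h (Complex (x + l) t)) y (y + m)
  - cint (fun t => h (Complex t (y + m))) x (x + l)
  - 'i%C * cint (fun t => h (Complex x t)) y (y + m).

Lemma rcont_h h y : (forall z, ccont h z) -> rcont (fun t => h (Complex t y)).
Proof. by move=> ch; apply: rcont_comp => //; exact: rcont_hline. Qed.
Lemma rcont_v h x : (forall z, ccont h z) -> rcont (fun t => h (Complex x t)).
Proof. by move=> ch; apply: rcont_comp => //; exact: rcont_vline. Qed.
Hint Resolve rcont_h rcont_v : core.

(** The inner sides of the four quarters are run through in both directions. *)
Lemma rect_int_split h x y l m : (forall z, ccont h z) -> 0 <= l -> 0 <= m ->
  rect_int h x y (l + l) (m + m) =
  rect_int h x y l m + rect_int h (x + l) y l m +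
  rect_int h x (y + m) l m + rect_int h (x + l) (y + m) l m.
Proof.
move=> ch l0 m0; rewrite /rect_int !addrA.
rewrite !(@cint_cat _ _ x (x + l) (x + l + l)) ?lerDl //; auto.
rewrite !(@cint_cat _ _ y (y + m) (y + m + m)) ?lerDl //; auto.
by do 12!(move: (cint _ _ _) => ?); ring.
Qed.

Lemma rect_intD h1 h2 x y l m : (forall z, ccont h1 z) -> (forall z, ccont h2 z) ->
  rect_int (fun z => h1 z + h2 z) x y l m = rect_int h1 x y l m + rect_int h2 x y l m.
Proof. by move=> c1 c2; rewrite /rect_int !cintD; auto; ring. Qed.

Lemma cint_id (a b : R) : a <= b ->
  cint (fun t => (t%:C)%C) a b = (((b ^+ 2 - a ^+ 2) / 2)%:C)%C.
Proof.
move=> ab.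
have dr (x : R) : is_derive x (1 : R) (fun x => Re ((x ^+ 2 / 2)%:C)%C) (Re (x%:C)%C).
  rewrite /=; apply: is_derive_eq; rewrite /GRing.scale /=; lra.
have di (x : R) : is_derive x (1 : R) (fun x => Im ((x ^+ 2 / 2)%:C)%C) (Im (x%:C)%C).
  by rewrite /=; apply: is_derive_eq.
rewrite (@cint_FTC _ _ _ a b (rcont_hline 0) ab dr di) -rmorphB.
by congr (_%:C)%C; lra.
Qed.

(** Affine functions have explicit primitives, and [c + d z] is the part of [h]
that differentiability does not make small. *)
Lemma rect_int_affine (c d : C) x y l m : 0 <= l -> 0 <= m ->
  rect_int (fun z => c + d * z) x y l m = 0.
Proof.
move=> l0 m0.
have cl (u v : C) (p q : R) : p <= q ->
    cint (fun t => u + v * (t%:C)%C) p q = u * ((q - p)%:C)%C + v * (((q ^+ 2 - p ^+ 2) / 2)%:C)%C.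
  move=> pq; rewrite cintD; [|exact: rcont_cst|apply: rcontZ; exact: (rcont_hline 0)].
  by rewrite cint_cst // cintZ ?cint_id //; exact: (rcont_hline 0).
have ch (v t : R) : Complex t v = (t%:C)%C + 'i%C * (v%:C)%C by rewrite [LHS]complexE.
rewrite /rect_int.
rewrite (_ : (fun t => c + d * Complex t y) = (fun t => (c + d * ('i%C * (y%:C)%C)) + d * (t%:C)%C)); last first.
  by apply/funext => t; rewrite ch; ring.
rewrite (_ : (fun t => c + d * Complex t (y + m)) = (fun t => (c + d * ('i%C * ((y + m)%:C)%C)) + d * (t%:C)%C)); last first.
  by apply/funext => t; rewrite ch; ring.
rewrite (_ : (fun t => c + d * Complex (x + l) t) = (fun t => (c + d * ((x + l)%:C)%C) + d * 'i%C * (t%:C)%C)); last first.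
  by apply/funext => t; rewrite ch; ring.
rewrite (_ : (fun t => c + d * Complex x t) = (fun t => (c + d * (x%:C)%C) + d * 'i%C * (t%:C)%C)); last first.
  by apply/funext => t; rewrite ch; ring.
rewrite !cl ?lerDl //.
have := @sqr_i R; set I := ('i%C : C) => I2.
set X := (x%:C)%C; set Y := (y%:C)%C; set L := (l%:C)%C; set M := (m%:C)%C.
have -> : (((x + l) ^+ 2 - x ^+ 2) / 2)%:C%C = X * L + L ^+ 2 / 2 by rewrite /X /L; field.
have -> : (((y + m) ^+ 2 - y ^+ 2) / 2)%:C%C = Y * M + M ^+ 2 / 2 by rewrite /Y /M; field.
rewrite (addrC x) (addrC y) !addrK !rmorphD /= -/X -/Y -/L -/M.
have -> : I * ((c + d * (L + X)) * M + d * I * (Y * M + M ^+ 2 / 2)) =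
  I * (c + d * (L + X)) * M - d * (Y * M + M ^+ 2 / 2).
  by transitivity (I * (c + d * (L + X)) * M + I ^+ 2 * d * (Y * M + M ^+ 2 / 2)); [ring|rewrite I2; ring].
have -> : I * ((c + d * X) * M + d * I * (Y * M + M ^+ 2 / 2)) =
  I * (c + d * X) * M - d * (Y * M + M ^+ 2 / 2).
  by transitivity (I * (c + d * X) * M + I ^+ 2 * d * (Y * M + M ^+ 2 / 2)); [ring|rewrite I2; ring].
ring.
Qed.

Definition in_rect x y l m (z : C) := (x <= Re z <= x + l) && (y <= Im z <= y + m).

Lemma rect_int_le h x y l m (K : R) : (forall z, ccont h z) -> 0 <= l -> 0 <= m ->
  (forall z, in_rect x y l m z -> cmod (h z) <= K) ->
  cmod (rect_int h x y l m) <= 4 * K * (l + m).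
Proof.
move=> ch l0 m0 hK; have xl : x <= x + l by rewrite lerDl.
have ym : y <= y + m by rewrite lerDl.
have Hh v : y <= v <= y + m -> cmod (cint (fun t => h (Complex t v)) x (x + l)) <= 2 * K * l.
  move=> vy; have := @cint_le _ (fun t => h (Complex t v)) x (x + l) K (rcont_h v ch) xl.
  rewrite (addrC x) addrK; apply => t tx; apply: hK.
  by rewrite /in_rect /= (addrC x) tx vy.
have Hv v : x <= v <= x + l -> cmod (cint (fun t => h (Complex v t)) y (y + m)) <= 2 * K * m.
  move=> vx; have := @cint_le _ (fun t => h (Complex v t)) y (y + m) K (rcont_v v ch) ym.
  rewrite (addrC y) addrK; apply => t ty; apply: hK.
  by rewrite /in_rect /= (addrC y) ty vx.
rewrite /rect_int (le_trans (cmodB _ _)) //.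
rewrite (_ : 4 * K * (l + m) = 2 * K * l + 2 * K * m + 2 * K * l + 2 * K * m); last by ring.
have Hi (z : C) : cmod ('i%C * z) = cmod z by rewrite cmodM cmodi mul1r.
apply: lerD; last by rewrite Hi; apply: Hv; rewrite lexx.
apply: le_trans (cmodB _ _) _; apply: lerD; last by apply: Hh; rewrite ym lexx.
apply: le_trans (cmodD _ _) _; apply: lerD; first by apply: Hh; rewrite lexx.
by rewrite Hi; apply: Hv; rewrite xl lexx.
Qed.

(** Only the error term of the affine approximation at [p] contributes, and it is
at most [e (l + m)] on a contour of length [2 (l + m)]. *)
Lemma rect_int_small h x y l m (p : C) (q : C -> C) (e : R) :
  (forall z, ccont h z) -> 0 <= l -> 0 <= m ->
  in_rect x y l m p -> (forall w, h w = h p + q w * (w - p)) ->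
  (forall w, in_rect x y l m w -> cmod (q w - q p) <= e) ->
  cmod (rect_int h x y l m) <= 4 * e * (l + m) ^+ 2.
Proof.
move=> ch l0 m0 pin hE qe.
pose aff := fun w : C => (h p - q p * p) + q p * w.
pose r := fun w => h w - aff w.
have ca z : ccont aff z.
  by apply: ccontD; [|apply: ccontM]; (exact: ccont_cst || exact: ccont_id).
have cr z : ccont r z by apply: ccontB.
rewrite (_ : h = (fun w => aff w + r w)); last by apply/funext => w; rewrite /r addrC subrK.
rewrite rect_intD // rect_int_affine // add0r.
rewrite (_ : 4 * e * (l + m) ^+ 2 = 4 * (e * (l + m)) * (l + m)); last by ring.
apply: rect_int_le => // z zin.
have -> : r z = (q z - q p) * (z - p) by rewrite /r /aff hE; ring.
rewrite cmodM ler_pM ?cmod_ge0 ?qe //.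
rewrite (le_trans (cmod_le_ReIm _)) // ReD ImD ReN ImN.
case/andP: zin => /andP[? ?] /andP[? ?]; case/andP: pin => /andP[? ?] /andP[? ?].
by rewrite lerD // ler_norml; apply/andP; split; lra.
Qed.

Lemma nested_intervals (a w : nat -> R) : (forall n, 0 <= w n) ->
  (forall n, a n <= a n.+1) -> (forall n, a n.+1 + w n.+1 <= a n + w n) ->
  exists c, forall n, a n <= c <= a n + w n.
Proof.
move=> w0 ainc binc.
have ha i j : (i <= j)%N -> a i <= a j.
  by move=> ij; apply: (@homo_leq _ a (fun u v => u <= v) (@lexx _ _) (fun x y z => @le_trans _ _ x y z)).
have hb i j : (i <= j)%N -> a j + w j <= a i + w i.
  move=> ij; apply: (@homo_leq _ (fun n => a n + w n) (fun u v => v <= u)) => //.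
  by move=> u v t uv vt; exact: le_trans vt uv.
have ub n : ubound (range a) (a n + w n).
  move=> _ [k _ <-]; rewrite (le_trans (ha k (maxn n k) (leq_maxr _ _))) //.
  by rewrite (le_trans _ (hb n _ (leq_maxl n k))) // lerDl.
exists (sup (range a)) => n; apply/andP; split.
  by apply: ub_le_sup; [exists (a 0%N + w 0%N); exact: ub|exists n].
by apply: ge_sup; [exists (a 0%N); exists 0%N|exact: ub].
Qed.

Lemma rect_int_quarter h x y l m : (forall z, ccont h z) -> 0 <= l -> 0 <= m ->
  exists p : R * R, [/\ x <= p.1 <= x + l, y <= p.2 <= y + m &
    cmod (rect_int h x y (l + l) (m + m)) <= 4 * cmod (rect_int h p.1 p.2 l m)].
Proof.
move=> ch l0 m0; rewrite rect_int_split //.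
set A := rect_int h x y l m; set B := rect_int h (x + l) y l m.
set C1 := rect_int h x (y + m) l m; set D := rect_int h (x + l) (y + m) l m.
have := cmodD (A + B + C1) D; have := cmodD (A + B) C1; have := cmodD A B.
set S := cmod (A + B + C1 + D) => h1 h2 h3.
have xl : x <= x <= x + l by rewrite lexx lerDl.
have xl' : x <= x + l <= x + l by rewrite lexx lerDl l0.
have ym : y <= y <= y + m by rewrite lexx lerDl.
have ym' : y <= y + m <= y + m by rewrite lexx lerDl m0.
have [?|?] := lerP S (4 * cmod A); first by exists (x, y).
have [?|?] := lerP S (4 * cmod B); first by exists (x + l, y).
have [?|?] := lerP S (4 * cmod C1); first by exists (x, y + m).
have [?|?] := lerP S (4 * cmod D); first by exists (x + l, y + m).
by clearbody S A B C1 D; exfalso; lra.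
Qed.

(** Goursat: repeatedly keeping the worst quarter of the rectangle leads to a
point at which differentiability forces the integral to be [o] of the area. *)
Theorem goursat h x y (L M : R) : (forall z, ccont h z) -> 0 <= L -> 0 <= M ->
  (forall z, in_rect x y L M z -> cdiff h z) -> rect_int h x y L M = 0.
Proof.
move=> ch L0 M0 dh; apply/eqP; rewrite -cmod_eq0; apply/negPn/negP => ne0.
have eta0 : 0 < cmod (rect_int h x y L M) by rewrite lt_neqAle eq_sym ne0 cmod_ge0.
set eta := cmod _ in eta0.
pose l n : R := L / 2 ^+ n; pose m n : R := M / 2 ^+ n.
have l0 n : 0 <= l n by rewrite divr_ge0 // exprn_ge0.
have m0 n : 0 <= m n by rewrite divr_ge0 // exprn_ge0.
have half (K : R) n : K / 2 ^+ n = K / 2 ^+ n.+1 + K / 2 ^+ n.+1.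
  by rewrite exprS; field; rewrite expf_neq0.
have stepP (n : nat) (p : R * R) : exists p' : R * R,
    [/\ p.1 <= p'.1 <= p.1 + l n.+1, p.2 <= p'.2 <= p.2 + m n.+1 &
     cmod (rect_int h p.1 p.2 (l n) (m n)) <= 4 * cmod (rect_int h p'.1 p'.2 (l n.+1) (m n.+1))].
  have -> : l n = l n.+1 + l n.+1 by exact: half.
  have -> : m n = m n.+1 + m n.+1 by exact: half.
  exact: (rect_int_quarter p.1 p.2 ch (l0 _) (m0 _)).
have stepS n := choice (stepP n).
pose step n := projT1 (stepS n); have stepE n := projT2 (stepS n); rewrite -/(step _) in stepE.
pose p := fix p n := if n is k.+1 then step k (p k) else (x, y).
have pS n : [/\ (p n).1 <= (p n.+1).1 <= (p n).1 + l n.+1,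
    (p n).2 <= (p n.+1).2 <= (p n).2 + m n.+1 &
     cmod (rect_int h (p n).1 (p n).2 (l n) (m n)) <=
     4 * cmod (rect_int h (p n.+1).1 (p n.+1).2 (l n.+1) (m n.+1))].
  exact: (stepE n (p n)).
have big n : eta / 4 ^+ n <= cmod (rect_int h (p n).1 (p n).2 (l n) (m n)).
  elim: n => [|n IH]; first by rewrite /l /m expr0 !divr1.
  have [_ _] := pS n => /(le_trans IH).
  by rewrite exprS invfM mulrCA ler_pdivrMl.
have [cx Hcx] : exists c, forall n, (p n).1 <= c <= (p n).1 + l n.
  apply: nested_intervals => // n; have [/andP[h1 h2] _ _] := pS n => //.
  by rewrite {2}/l (half L); rewrite -/(l n.+1); lra.
have [cy Hcy] : exists c, forall n, (p n).2 <= c <= (p n).2 + m n.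
  apply: nested_intervals => // n; have [_ /andP[h1 h2] _] := pS n => //.
  by rewrite {2}/m (half M); rewrite -/(m n.+1); lra.
have /dh[q qc hE] : in_rect x y L M (Complex cx cy).
  have := Hcx 0%N; have := Hcy 0%N; rewrite /in_rect /l /m expr0 !divr1 /=.
  by move=> -> ->.
pose e := eta / (8 * ((L + M) ^+ 2 + 1)).
have LM0 : 0 <= (L + M) ^+ 2 by exact: sqr_ge0.
have e0 : 0 < e by rewrite divr_gt0 // mulr_gt0 // ltr_pwDr.
have [d d0 Hd] := qc e e0.
have [n Hn] : exists n : nat, (L + M) / 2 ^+ n < d.
  have /cvgrPdist_lt/(_ d d0)[n _ Hn] : (fun n => (L + M) * 2^-1 ^+ n) @ \oo --> (L + M) * (0 : R).
    apply: cvgM; first exact: cvg_cst.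
    by apply: cvg_expr; rewrite ger0_norm ?invr_ge0 // invf_lt1 // ltr1n.
  exists n; have := Hn n (leqnn n); rewrite mulr0 sub0r normrN exprVn.
  exact: le_lt_trans (ler_norm _).
have inr : in_rect (p n).1 (p n).2 (l n) (m n) (Complex cx cy).
  by rewrite /in_rect /= Hcx Hcy.
have := @rect_int_small h _ _ _ _ _ q e ch (l0 n) (m0 n) inr hE.
have H2 w : in_rect (p n).1 (p n).2 (l n) (m n) w -> cmod (q w - q (Complex cx cy)) <= e.
  move=> win; apply/ltW/Hd; apply: le_lt_trans Hn.
  rewrite (le_trans (cmod_le_ReIm _)) // ReD ImD ReN ImN mulrDl.
  case/andP: win => /andP[? ?] /andP[? ?]; case/andP: inr => /andP[? ?] /andP[? ?].
  by rewrite lerD // -/(l n) -/(m n) ler_norml; apply/andP; split; lra.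
move=> /(_ H2) /(le_trans (big n)).
rewrite /l /m -mulrDl expr_div_n -exprM mulnC exprM (_ : 2 ^+ 2 = 4 :> R); last by rewrite expr2 -natrM.
rewrite mulrA ler_pM2r ?invr_gt0 ?exprn_gt0 //.
apply/negP; rewrite -ltNge.
have eE : e * (8 * ((L + M) ^+ 2 + 1)) = eta.
  by rewrite /e mulfVK // gt_eqF // mulr_gt0 // ltr_pwDr.
rewrite -eE; nra.
Qed.

End Goursat.

(** * The complex exponential *)

Section ComplexExp.
Variable R : realType.
Local Notation C := (R[i]).
Implicit Types (f g : C -> C) (z w : C) (r t : R).

Definition cis t : C := Complex (cos t) (sin t).
Definition cexp z : C := ((expR (Re z))%:C)%C * cis (Im z).

Lemma cmod_cis t : cmod (cis t) = 1.
Proof. by rewrite cmodE /= cos2Dsin2 sqrtr1. Qed.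
Lemma cisD s t : cis (s + t) = cis s * cis t.
Proof. by rewrite /cis cosD sinD; apply: eq_ReIm; rewrite ?ReM ?ImM //= [RHS]addrC. Qed.
Lemma cis2pi t : cis (t + pi *+ 2) = cis t.
Proof. by rewrite /cis cosD2pi sinD2pi. Qed.

Lemma cmod_cexp z : cmod (cexp z) = expR (Re z).
Proof. by rewrite cmodM cmod_cis mulr1 cmod_real ger0_norm // expR_ge0. Qed.
Lemma cexpD z w : cexp (z + w) = cexp z * cexp w.
Proof. by rewrite /cexp ReD ImD expRD cisD rmorphM; ring. Qed.

Lemma derive_little_o (F : R -> R) (D : R) : is_derive (0 : R) (1 : R) F D ->
  forall e : R, 0 < e -> exists2 d : R, 0 < d &
    forall t, `|t| < d -> `|F t - F 0 - D * t| <= e * `|t|.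
Proof.
move=> dF e e0.
have DE := @derive_val _ _ _ _ _ _ _ dF.
have /cvg_ex[l Hl] := @ex_derive _ _ _ _ _ _ _ dF.
have lE : l = D by rewrite -DE; apply/esym/cvg_lim.
move: Hl; rewrite lE => /cvgrPdist_le/(_ _ e0)/nbhs_ballP[d /= d0 H].
exists d => // t td; have [->|t0] := eqVneq t 0; first by rewrite subrr mulr0 subrr normr0 mulr0.
have := H t; rewrite /ball /= sub0r normrN => /(_ td t0).
rewrite /= addr0 /GRing.scale /= mulr1 => H1.
have -> : F t - F 0 - D * t = - ((D - t^-1 * (F t - F 0)) * t) by field.
by rewrite normrN normrM ler_wpM2r.
Qed.

Lemma cdiff_little_o f z (D : C) :
  (forall e : R, 0 < e -> exists2 d : R, 0 < d &
    forall h : C, cmod h < d -> cmod (f (z + h) - f z - D * h) <= e * cmod h) -> cdiff f z.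
Proof.
move=> H; exists (fun w => if w == z then D else (f w - f z) / (w - z)); last first.
  move=> w; case: eqP => [->|/eqP wz]; first by rewrite subrr mulr0 addr0.
  by rewrite mulfVK ?subr_eq0 // addrC subrK.
move=> e e0; have e2 : 0 < e / 2 by rewrite divr_gt0.
have [d d0 Hd] := H _ e2; exists d => // w wz; rewrite eqxx; have [_|wz0] := eqVneq w z.
  by rewrite subrr cmod0.
have wz0' : w - z != 0 by rewrite subr_eq0.
have := Hd _ wz; rewrite (addrC z) subrK.
have -> : f w - f z - D * (w - z) = ((f w - f z) / (w - z) - D) * (w - z) by field.
rewrite cmodM ler_pM2r ?cmod_gt0 // => /le_lt_trans; apply.
by rewrite ltr_pdivrMr // ltr_pMr // ltr1n.
Qed.

Lemma cdiff_cexp z : cdiff cexp z.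
Proof.
apply: (@cdiff_little_o _ _ (cexp z)) => e e0.
pose k := expR (Re z); have k0 : 0 < k := expR_gt0 _.
pose e' := e / (8 * k); have e'0 : 0 < e' by rewrite divr_gt0 // mulr_gt0.
have [d1 d10 H1] := derive_little_o (is_derive_expR (0 : R)) e'0.
have [d2 d20 H2] := derive_little_o (is_derive_cos (0 : R)) e'0.
have [d3 d30 H3] := derive_little_o (is_derive_sin (0 : R)) e'0.
exists (Num.min (Num.min d1 d2) (Num.min (Num.min d3 e') 1)).
  by rewrite !lt_min d10 d20 d30 e'0 ltr01.
move=> h; rewrite !lt_min => /andP[/andP[h1 h2] /andP[/andP[h3 h4] h5]].
rewrite cexpD -{2}(mulr1 (cexp z)) -!mulrBr cmodM cmod_cexp -/k.
have hs := Re_le_cmod h; have ht := Im_le_cmod h.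
set s := Re h in hs; set t := Im h in ht; set c := cmod h in h1 h2 h3 h4 h5 hs ht *.
have c0 : 0 <= c := cmod_ge0 h.
have := H1 s (le_lt_trans hs h1); rewrite expR0 mul1r => e1.
have := H2 t (le_lt_trans ht h2); rewrite cos0 sin0 oppr0 mul0r subr0 => e2.
have := H3 t (le_lt_trans ht h3); rewrite cos0 sin0 subr0 mul1r => e3.
(* The three summands are the errors of [exp] and [cis] and a product of
   increments; each is small compared with [c]. *)
have -> : cexp h - 1 - h = ((expR s - 1 - s)%:C)%C * cis t
    + ((1 + s)%:C)%C * (Complex (cos t - 1) (sin t - t)) + 'i%C * ((s * t)%:C)%C.
  apply: eq_ReIm; rewrite /cexp -/s -/t !(ReD, ImD, ReN, ImN, ReM, ImM) /= -/s -/t; ring.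
have B1 : cmod (((expR s - 1 - s)%:C)%C * cis t) <= e' * c.
  rewrite cmodM cmod_cis mulr1 cmod_real (le_trans e1) // ler_wpM2l // ltW //.
have B2 : cmod (((1 + s)%:C)%C * (Complex (cos t - 1) (sin t - t))) <= 4 * e' * c.
  rewrite cmodM cmod_real.
  have -> : 4 * e' * c = 2 * (e' * c + e' * c) by ring.
  apply: ler_pM; rewrite ?cmod_ge0 //.
    by rewrite (le_trans (ler_normD _ _)) // normr1; have := ltW h5; lra.
  apply: (le_trans (cmod_le_ReIm _)); rewrite /= lerD //.
    by rewrite (le_trans e2) // ler_wpM2l // ltW.
  by rewrite (le_trans e3) // ler_wpM2l // ltW.
have B3 : cmod ('i%C * ((s * t)%:C)%C) <= e' * c.
  rewrite cmodM cmodi mul1r cmod_real normrM ler_pM //.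
  exact: le_trans hs (ltW h4).
have B : cmod (((expR s - 1 - s)%:C)%C * cis t
    + ((1 + s)%:C)%C * (Complex (cos t - 1) (sin t - t)) + 'i%C * ((s * t)%:C)%C) <= 6 * e' * c.
  have -> : 6 * e' * c = e' * c + 4 * e' * c + e' * c by ring.
  apply: le_trans (cmodD _ _) _; apply: lerD => //.
  by apply: le_trans (cmodD _ _) _; apply: lerD.
apply: le_trans (ler_wpM2l (ltW k0) B) _.
have -> : k * (6 * e' * c) = (6 / 8) * (e * c).
  by rewrite /e'; field; rewrite gt_eqF.
rewrite ler_piMl ?mulr_ge0 ?(ltW e0) //; lra.
Qed.

Lemma rcont_cis : rcont cis.
Proof.
by apply: rcont_ReIm; [exact: continuous_cos|exact: continuous_sin].
Qed.

End ComplexExp.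

(** * Means over circles *)

Section CircleMeans.
Variable R : realType.
Local Notation C := (R[i]).
Implicit Types (f g : C -> C) (z w a : C) (r t : R).

Local Notation twopi := (pi *+ 2 : R).

(** Unnormalised: [2 pi] times the mean of [g] over the circle of radius [r]. *)
Definition circ g r : C := cint (fun t => g ((r%:C)%C * cis t)) 0 twopi.

Lemma twopi_gt0 : 0 < twopi. Proof. by rewrite pmulrn_lgt0 // pi_gt0. Qed.
Lemma twopi_ge0 : 0 <= twopi. Proof. exact/ltW/twopi_gt0. Qed.
Hint Resolve twopi_gt0 twopi_ge0 : core.

Lemma cmod_circle r t : 0 <= r -> cmod ((r%:C)%C * cis t) = r.
Proof. by move=> r0; rewrite cmodM cmod_cis mulr1 cmod_real ger0_norm. Qed.

Lemma rcont_circle r g : (forall t, ccont g ((r%:C)%C * cis t)) ->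
  rcont (fun t => g ((r%:C)%C * cis t)).
Proof.
by move=> cg; apply: (@rcont_comp _ (fun t => (r%:C)%C * cis t)) => //; apply: rcontZ; exact: rcont_cis.
Qed.

Definition ccont_on r g := forall z, cmod z = r -> ccont g z.

Lemma rcont_on r g : 0 <= r -> ccont_on r g -> rcont (fun t => g ((r%:C)%C * cis t)).
Proof. by move=> r0 cg; apply: rcont_circle => t; apply: cg; rewrite cmod_circle. Qed.

Lemma circD f g r : 0 <= r -> ccont_on r f -> ccont_on r g ->
  circ (fun z => f z + g z) r = circ f r + circ g r.
Proof. by move=> r0 cf cg; rewrite /circ cintD //; exact: rcont_on. Qed.

Lemma circZ (k : C) g r : 0 <= r -> ccont_on r g -> circ (fun z => k * g z) r = k * circ g r.
Proof. by move=> r0 cg; rewrite /circ cintZ //; exact: rcont_on. Qed.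

Lemma circ_le g r (K : R) : 0 <= r -> ccont_on r g -> (forall z, cmod z = r -> cmod (g z) <= K) ->
  cmod (circ g r) <= 2 * K * twopi.
Proof.
move=> r0 cg gK; have := @cint_le _ (fun t => g ((r%:C)%C * cis t)) 0 twopi K (rcont_on r0 cg) twopi_ge0.
by rewrite subr0; apply => t _; apply: gK; rewrite cmod_circle.
Qed.

Lemma eq_circ f g r : 0 <= r -> (forall z, cmod z = r -> f z = g z) -> circ f r = circ g r.
Proof. by move=> r0 fg; apply: eq_cint => t _; apply: fg; rewrite cmod_circle. Qed.

Lemma circ_cst (k : C) r : circ (fun=> k) r = k * (twopi%:C)%C.
Proof. by rewrite /circ cint_cst // subr0. Qed.

(** Goursat in the logarithmic coordinate: the two horizontal sides of the
rectangle have the same image under the exponential, so they cancel. *)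
Lemma circ_const g r1 r2 : 0 < r1 -> r1 <= r2 -> (forall z, z != 0 -> ccont g z) ->
  (forall z, r1 <= cmod z <= r2 -> cdiff g z) -> circ g r1 = circ g r2.
Proof.
move=> r10 r12 cg dg; have r20 : 0 < r2 := lt_le_trans r10 r12.
have e0 z : cexp z != 0 by rewrite -cmod_gt0 cmod_cexp expR_gt0.
have lnr : 0 <= ln r2 - ln r1 by rewrite subr_ge0 ler_ln.
have ch z : ccont (g \o @cexp R) z.
  by apply: ccont_comp; [exact/cdiff_ccont/cdiff_cexp|exact: cg].
have := @goursat R (g \o @cexp R) (ln r1) 0 (ln r2 - ln r1) twopi ch lnr twopi_ge0.
have Hd z : in_rect (ln r1) 0 (ln r2 - ln r1) twopi z -> cdiff (g \o @cexp R) z.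
  move=> /andP[]; rewrite (addrC (ln r1)) subrK => zr _.
  apply: cdiff_comp; first exact: cdiff_cexp.
  apply: dg; rewrite cmod_cexp; case/andP: zr => [h1 h2].
  by rewrite -{1}(lnK r10) -(lnK r20) !ler_expR h1.
move=> /(_ Hd); rewrite /rect_int (addrC (ln r1)) subrK add0r.
have -> : (fun t => (g \o @cexp R) (Complex t twopi)) = (fun t => (g \o @cexp R) (Complex t 0)).
  by apply/funext => t; rewrite /= /cexp /= -[twopi]add0r cis2pi.
have -> : (fun t => (g \o @cexp R) (Complex (ln r2) t)) = (fun t => g ((r2%:C)%C * cis t)).
  by apply/funext => t; rewrite /= /cexp /= lnK.
have -> : (fun t => (g \o @cexp R) (Complex (ln r1) t)) = (fun t => g ((r1%:C)%C * cis t)).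
  by apply/funext => t; rewrite /= /cexp /= lnK.
rewrite -/(circ g r1) -/(circ g r2); set A := cint _ (ln r1) _.
rewrite (addrC A) addrK -mulrBr => /eqP.
by rewrite mulf_eq0 -cmod_eq0 cmodi oner_eq0 /= subr_eq0 => /eqP ->.
Qed.

(** By compactness of the circle, [g] is uniformly close to itself on nearby
circles. *)
Lemma circ_cont g r0 (e : R) : 0 <= r0 -> (forall z, ccont g z) -> 0 < e ->
  exists2 d : R, 0 < d & forall r, 0 <= r -> `|r - r0| < d ->
    cmod (circ g r - circ g r0) <= e.
Proof.
move=> r00 cg e0; pose e' := e / (2 * twopi).
have e'0 : 0 < e' by rewrite divr_gt0 // mulr_gt0.
have /compact_near_coveringP/near_covering_withinP : compact `[0, twopi : R] by exact: segment_compact.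
pose P r t := cmod (g ((r%:C)%C * cis t) - g ((r0%:C)%C * cis t)) < e'.
move=> /(_ _ (nbhs r0) P _)[].
  move=> t _; have e'2 : 0 < e' / 2 by rewrite divr_gt0.
  have [d d0 Hd] := cg ((r0%:C)%C * cis t) _ e'2.
  have d2 : 0 < d / (2 * (r0 + 1)) by rewrite divr_gt0 // mulr_gt0 // ltr_wpDl.
  have [d1 d10 H1] := @rcont_cis R t _ d2.
  have B t' : `|t' - t| < d1 -> r0 * cmod (cis t' - cis t) < d / 2.
    move=> /H1; rewrite ltr_pdivlMr ?mulr_gt0 ?ltr_wpDl // => H2.
    by have := cmod_ge0 (cis t' - cis t); nra.
  have B' r t' : `|r - r0| < d / 2 -> `|t' - t| < d1 ->
      cmod ((r%:C)%C * cis t' - (r0%:C)%C * cis t) < d.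
    move=> rr /B tt.
    have -> : (r%:C)%C * cis t' - (r0%:C)%C * cis t = ((r - r0)%:C)%C * cis t' + (r0%:C)%C * (cis t' - cis t).
      by rewrite rmorphB; ring.
    rewrite (le_lt_trans (cmodD _ _)) // !cmodM cmod_cis mulr1 !cmod_real (ger0_norm r00).
    by rewrite (splitr d) ltrD.
  exists (ball t d1, ball r0 (d / 2)).
    by split; apply: nbhsx_ballx => //; rewrite divr_gt0.
  case=> t' r [/= ]; rewrite /ball /= distrC => tt; rewrite distrC => rr _.
  rewrite /P (_ : _ - _ = (g ((r%:C)%C * cis t') - g ((r0%:C)%C * cis t)) -
    (g ((r0%:C)%C * cis t') - g ((r0%:C)%C * cis t))); last by ring.
  rewrite (le_lt_trans (cmodB _ _)) // (splitr e') ltrD // Hd //; first exact: B'.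
  by apply: B' => //; rewrite subrr normr0 divr_gt0.
move=> d /= d0 Hd; exists d => // r rpos rr.
have cr s : rcont (fun t => g ((s%:C)%C * cis t)) by apply: rcont_circle.
have -> : circ g r - circ g r0 = cint (fun t => g ((r%:C)%C * cis t) - g ((r0%:C)%C * cis t)) 0 twopi.
  by rewrite /circ [RHS]cintB.
have := @cint_le _ (fun t => g ((r%:C)%C * cis t) - g ((r0%:C)%C * cis t)) 0 twopi e' _ twopi_ge0.
rewrite subr0 (_ : 2 * e' * twopi = e); last first.
  have : twopi != 0 by rewrite gt_eqF.
  by rewrite /e'; move: (twopi) => q q0; field.
apply.
  by rewrite (_ : (fun t => _) = (fun t => g ((r%:C)%C * cis t) + (-1) * g ((r0%:C)%C * cis t)));
   [apply: rcontD => //; exact: rcontZ|apply/funext => t; rewrite mulN1r].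
move=> t tI; apply/ltW; apply: (Hd r); first by rewrite /ball_ /= distrC.
by rewrite /= in_itv /=.
Qed.

End CircleMeans.

(** * Cauchy's formula and Taylor expansion *)

Section Taylor.
Variable R : realType.
Local Notation C := (R[i]).
Implicit Types (f g : C -> C) (z w a : C) (r t : R).
Local Notation twopi := (pi *+ 2 : R).

Lemma eps_eq0 (u : C) (K : R) : (forall e : R, 0 < e -> cmod u <= K * e) -> u = 0.
Proof.
move=> H; apply/eqP; rewrite -cmod_eq0; apply/negPn/negP => u0.
have u1 : 0 < cmod u by rewrite lt0r u0 cmod_ge0.
have K1 : 0 < `|K| + 1 by rewrite ltr_wpDl.
have := H (cmod u / (2 * (`|K| + 1))) _.
rewrite divr_gt0 ?mulr_gt0 // => /(_ isT); apply/negP; rewrite -ltNge.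
rewrite mulrCA gtr_pMr // ltr_pdivrMr ?mulr_gt0 // mul1r.
by have := ler_norm K; lra.
Qed.

(** Continuity carries the constancy of the means to the two boundary circles, so
that an exceptional point may lie on one of them. *)
Lemma circ_const_cont g r1 r2 : 0 <= r1 -> r1 <= r2 -> (forall z, ccont g z) ->
  (forall z, r1 < cmod z < r2 -> cdiff g z) -> circ g r1 = circ g r2.
Proof.
move=> r10; rewrite le_eqVlt => /predU1P[-> //|r12] cg dg.
apply/eqP; rewrite -subr_eq0; apply/eqP/(@eps_eq0 _ 2) => e e0.
have [d1 d10 H1] := circ_cont r10 cg e0.
have [d2 d20 H2] := circ_cont (ltW (le_lt_trans r10 r12)) cg e0.
pose d := Num.min (Num.min d1 d2) (r2 - r1) / 3.
have d0 : 0 < d by rewrite divr_gt0 // !lt_min d10 d20 subr_gt0.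
have [dd1 dd2 dd3] : [/\ d < d1, d < d2 & d <= (r2 - r1) / 3].
  rewrite /d; set m := Num.min _ (r2 - r1).
  have : m <= d1 /\ m <= d2 /\ m <= r2 - r1.
    by rewrite /m !ge_min !lexx !orbT.
  have m0 : 0 < m by rewrite /m !lt_min d10 d20 subr_gt0.
  by move: (m) m0 => {}m m0 [h1 [h2 h3]]; split; lra.
have h1 := H1 (r1 + d); have h2 := H2 (r2 - d).
have Eq : circ g (r1 + d) = circ g (r2 - d).
  apply: circ_const => //; [lra|lra|move=> z /andP[? ?]; apply: dg; apply/andP; split; lra].
have -> : circ g r1 - circ g r2 = (circ g (r2 - d) - circ g r2) - (circ g (r1 + d) - circ g r1).
  by rewrite Eq; ring.
rewrite (le_trans (cmodB _ _)) // mulr_natl mulr2n lerD //.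
  by apply: h2; [lra|rewrite addrAC subrr add0r normrN gtr0_norm].
by apply: h1; [lra|rewrite addrAC subrr add0r gtr0_norm].
Qed.

Definition series_to (F : nat -> C) (l : C) := forall e : R, 0 < e ->
  exists n0, forall n, (n0 <= n)%N -> cmod (l - \sum_(i < n) F i) < e.

Lemma circle_bounded g r : (forall t, ccont g ((r%:C)%C * cis t)) ->
  exists2 K : R, 0 <= K & forall t, 0 <= t <= twopi -> cmod (g ((r%:C)%C * cis t)) <= K.
Proof.
move=> cg; have cu := rcont_circle cg; set u := fun t => _ in cu.
have cv : continuous (fun t => cmod (u t)).
  move=> x; apply/cvgrPdist_lt => e e0; have [d d0 H] := cu x e e0.
  apply/nbhs_ballP; exists d => //= y; rewrite /ball /= distrC => /H yx.
  by rewrite (le_lt_trans _ yx) // distrC cmod_dist.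
have [c _ Hc] := @EVT_max R _ 0 twopi (twopi_ge0 R) (continuous_subspaceT cv).
by exists (cmod (u c)) => [|t tI]; [exact: cmod_ge0|apply: Hc; rewrite in_itv].
Qed.

Lemma circ_le_angle g r (K : R) : (forall t, ccont g ((r%:C)%C * cis t)) ->
  (forall t, 0 <= t <= twopi -> cmod (g ((r%:C)%C * cis t)) <= K) ->
  cmod (circ g r) <= 2 * K * twopi.
Proof.
move=> cg gK; have := @cint_le _ (fun t => g ((r%:C)%C * cis t)) 0 twopi K (rcont_circle cg) (twopi_ge0 R).
by rewrite subr0; apply.
Qed.

Lemma ccontVX n z : z != 0 -> ccont (fun w => (w ^+ n)^-1) z.
Proof.
move=> z0; apply/cdiff_ccont/cdiffV; last exact/cdiffX/cdiff_id.
by rewrite expf_neq0.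
Qed.

(** The integral does not depend on the radius and vanishes as the radius grows. *)
Lemma circ_negX n r : 0 < r -> (0 < n)%N -> circ (fun z => (z ^+ n)^-1) r = 0.
Proof.
move=> r0 n0.
have cst s1 s2 : 0 < s1 -> s1 <= s2 -> circ (fun z => (z ^+ n)^-1) s1 = circ (fun z => (z ^+ n)^-1) s2.
  move=> s10 s12; apply: circ_const => //; first by move=> z z0; exact: ccontVX.
  move=> z /andP[zs _]; apply: cdiffV; last exact/cdiffX/cdiff_id.
  by rewrite expf_neq0 // -cmod_gt0 (lt_le_trans s10).
apply: (@eps_eq0 _ (2 * twopi)) => e e0.
pose s := Num.max r (Num.max 1 e^-1).
have s1 : 1 <= s by rewrite /s !le_max lexx orbT.
have s0 : 0 < s := lt_le_trans ltr01 s1.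
have se : s^-1 <= e by rewrite invf_ple ?posrE // /s !le_max lexx !orbT.
rewrite (cst r s) ?le_max ?lexx // mulrAC; apply: circ_le; first exact: ltW.
  by move=> z zs; apply: ccontVX; rewrite -cmod_gt0 zs.
move=> z zs; rewrite cmodV cmodX zs; apply: le_trans se.
by rewrite lef_pV2 ?posrE ?exprn_gt0 // -{1}(expr1 s) ler_weXn2l.
Qed.

(** Every positive radius gives the same value, by [circ_coef]. *)
Definition tcoef f n : C := circ (fun z => f z * (z ^+ n)^-1) 1 / (twopi%:C)%C.

Lemma circ_coef f n r : entire f -> 0 < r ->
  circ (fun z => f z * (z ^+ n)^-1) r = tcoef f n * (twopi%:C)%C.
Proof.
move=> /entireP df r0.
have cst s1 s2 : 0 < s1 -> s1 <= s2 ->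
    circ (fun z => f z * (z ^+ n)^-1) s1 = circ (fun z => f z * (z ^+ n)^-1) s2.
  move=> s10 s12; apply: circ_const => //.
    by move=> z z0; apply: ccontM; [exact: cdiff_ccont|exact: ccontVX].
  move=> z /andP[zs _]; apply: cdiffM => //; apply: cdiffV; last exact/cdiffX/cdiff_id.
  by rewrite expf_neq0 // -cmod_gt0 (lt_le_trans s10).
rewrite /tcoef mulfVK; last by rewrite -cmod_gt0 cmod_real gtr0_norm ?twopi_gt0.
by have [r1|r1] := leP r 1; [apply: cst|apply/esym/cst; rewrite ?ltW].
Qed.

Lemma tcoef_le f n r (K : R) : entire f -> 0 < r ->
  (forall t, 0 <= t <= twopi -> cmod (f ((r%:C)%C * cis t)) <= K) -> cmod (tcoef f n) * r ^+ n <= 2 * K.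
Proof.
move=> ef r0 fK; have /entireP df := ef.
have nz t : (r%:C)%C * cis t != 0 by rewrite -cmod_gt0 cmod_circle // ltW.
have := @circ_le_angle (fun z => f z * (z ^+ n)^-1) r (K / r ^+ n).
rewrite circ_coef // cmodM cmod_real gtr0_norm ?twopi_gt0 // ler_pM2r ?twopi_gt0 //.
rewrite mulrA ler_pdivlMr ?exprn_gt0 //; apply.
  by move=> t; apply: ccontM; [exact: cdiff_ccont|exact: ccontVX].
move=> t tI; rewrite cmodM cmodV cmodX cmod_circle ?(ltW r0) // ler_pM2r ?fK //.
by rewrite invr_gt0 exprn_gt0.
Qed.

(** The difference quotient [q] of [f] at [a] is holomorphic off [a] and continuous
at [a], so the mean of [z q z] is the same on all circles, across [a] as well, and
it vanishes at radius 0.  Cauchy's formula is this identity with [q] written out. *)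
Lemma cauchy_mean f a r : entire f -> cmod a < r ->
  exists q : C -> C, [/\ forall w, f w = f a + q w * (w - a), forall w, ccont q w &
    circ (fun z => z * q z) r = 0].
Proof.
move=> /entireP df ar; have [q qa fE] := df a.
have dq w : w != a -> cdiff q w.
  move=> wa; apply: (@cdiff_local _ (fun w => (f w - f a) * (w - a)^-1) _ _ (cmod (w - a))).
  - by rewrite cmod_gt0 subr_eq0.
  - move=> v vw; rewrite fE addrAC subrr add0r mulfK // subr_eq0; apply/eqP => va.
    by move: vw; rewrite va cmod_subC ltxx.
  - apply: cdiffM; first by apply: cdiffB => //; exact: cdiff_cst.
    by apply: cdiffV; [rewrite subr_eq0|apply: cdiffB; [exact: cdiff_id|exact: cdiff_cst]].
have cq w : ccont q w by have [->//|/dq/cdiff_ccont] := eqVneq w a.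
exists q; split=> //; have cg z : ccont (fun z => z * q z) z.
  by apply: ccontM => //; exact: ccont_id.
have dg z : z != a -> cdiff (fun z => z * q z) z.
  by move=> za; apply: cdiffM; [exact: cdiff_id|exact: dq].
have <- : circ (fun z => z * q z) (cmod a) = circ (fun z => z * q z) r.
  apply: circ_const_cont => //; [exact: cmod_ge0|exact: ltW|move=> z /andP[za _]].
  by apply: dg; apply: contraTneq za => ->; rewrite ltxx.
have <- : circ (fun z => z * q z) 0 = circ (fun z => z * q z) (cmod a).
  apply: circ_const_cont => //; [exact: cmod_ge0|move=> z /andP[_ za]].
  by apply: dg; apply: contraTneq za => ->; rewrite ltxx.
rewrite (@eq_circ _ _ (fun=> 0)) // ?circ_cst ?mul0r // => z /eqP.
by rewrite cmod_eq0 => /eqP ->; rewrite mul0r.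
Qed.

(** Dividing [z q z] by one more power of [z] peels off one Taylor term:
[E n = a E (n + 1) + 2 pi c_n - (f a) circ (z^-n)].  Since [E 0 = 0] by Cauchy,
the partial sums miss [f a] by [a^n E n / (2 pi)], which is geometrically small
on a circle of radius larger than [|a|]. *)
Theorem taylor f : entire f -> forall z, series_to (fun n => tcoef f n * z ^+ n) (f z).
Proof.
move=> ef a; have /entireP df := ef.
pose r := cmod a + 1; have ar : cmod a < r by rewrite ltrDl.
have r0 : 0 < r := le_lt_trans (cmod_ge0 a) ar.
have [q [fE cq c0]] := cauchy_mean ef ar.
have nz z : cmod z = r -> z != 0 by move=> zr; rewrite -cmod_gt0 zr.
pose T : C := (twopi%:C)%C.
have T0 : T != 0 by rewrite -cmod_gt0 cmod_real gtr0_norm ?twopi_gt0.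
pose E n := circ (fun z => z * q z * (z ^+ n)^-1) r.
have cE n : ccont_on r (fun z => z * q z * (z ^+ n)^-1).
  move=> z /nz z0; apply: ccontM; last exact: ccontVX.
  by apply: ccontM => //; exact: ccont_id.
have cf n : ccont_on r (fun z => f z * (z ^+ n)^-1).
  by move=> z /nz z0; apply: ccontM; [exact: cdiff_ccont|exact: ccontVX].
have ES n : E n = a * E n.+1 + tcoef f n * T - f a * circ (fun z => (z ^+ n)^-1) r.
  have cV : ccont_on r (fun z => (z ^+ n)^-1) by move=> z /nz z0; exact: ccontVX.
  have cZ (k : C) g : ccont_on r g -> ccont_on r (fun z => k * g z).
    by move=> cg z /cg; apply: ccontM; exact: ccont_cst.
  have cD g h : ccont_on r g -> ccont_on r h -> ccont_on r (fun z => g z + h z).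
    by move=> cg ch z zr; apply: ccontD; [exact: cg|exact: ch].
  rewrite -(circ_coef n ef r0) -(circZ a (ltW r0) (cE n.+1)).
  rewrite -(circD (ltW r0) (cZ a _ (cE n.+1)) (cf n)).
  rewrite -mulNr -(circZ (- f a) (ltW r0) cV).
  rewrite -(circD (ltW r0) (cD _ _ (cZ a _ (cE n.+1)) (cf n)) (cZ (- f a) _ cV)).
  apply: eq_circ; first exact: ltW.
  move=> z zr; rewrite (fE z) exprS; have := nz z zr => z0; field.
  by rewrite z0 expf_neq0.
have EN n : 0 = T * (\sum_(i < n.+1) tcoef f i * a ^+ i - f a) + a ^+ n.+1 * E n.+1.
  elim: n => [|n IH].
    rewrite big_ord1 !expr0 mulr1 expr1.
    have := ES 0%N; rewrite /E (_ : (fun z => z * q z * (z ^+ 0)^-1) = (fun z => z * q z)); last first.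
      by apply/funext => z; rewrite expr0 invr1 mulr1.
    rewrite c0 => {1}->.
    rewrite (_ : (fun z => (z ^+ 0)^-1) = (fun=> 1)); last by apply/funext => z; rewrite expr0 invr1.
    by rewrite circ_cst mul1r -/T; ring.
  rewrite {1}IH [in RHS]big_ord_recr /= (ES n.+1) circ_negX // mulr0 subr0 (exprS _ n.+1).
  ring.
have [K K0 HK] := @circle_bounded (fun z => z * q z) r (fun t => ccontM (@ccont_id _ _) (cq _)).
have EB n : cmod (E n) <= 2 * (K / r ^+ n) * twopi.
  apply: circ_le_angle => [t|t tI]; first by apply: cE; rewrite cmod_circle // ltW.
  rewrite cmodM cmodV cmodX cmod_circle ?(ltW r0) // ler_pM2r ?HK //.
  by rewrite invr_gt0 exprn_gt0.
move=> e e0.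
have : (fun n => 2 * K * (cmod a / r) ^+ n) @ \oo --> 2 * K * (0 : R).
  apply: cvgM; first exact: cvg_cst.
  apply: cvg_expr; rewrite ger0_norm ?divr_ge0 ?cmod_ge0 ?(ltW r0) //.
  by rewrite ltr_pdivrMr // mul1r.
rewrite mulr0 => /cvgrPdist_lt/(_ _ e0)[n0 _ H].
exists n0.+1 => -[//|n] nn; have := H n.+1 (leqW nn).
rewrite /= sub0r normrN; apply: le_lt_trans; apply: le_trans (ler_norm _).
have -> : f a - \sum_(i < n.+1) tcoef f i * a ^+ i = a ^+ n.+1 * E n.+1 / T.
  apply: (mulfI T0); rewrite (mulrCA T) mulfV // mulr1.
  by rewrite -[RHS](addKr (T * (\sum_(i < n.+1) tcoef f i * a ^+ i - f a))) -EN; ring.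
rewrite cmodM cmodV cmod_real gtr0_norm ?twopi_gt0 // cmodM cmodX ler_pdivrMr ?twopi_gt0 //.
apply: (le_trans (ler_wpM2l (exprn_ge0 _ (cmod_ge0 _)) (EB _))).
rewrite expr_div_n le_eqVlt; apply/orP; left; apply/eqP.
by have := expf_neq0 n.+1 (lt0r_neq0 r0) => rn0; field.
Qed.

End Taylor.

(** * Power series and the growth of entire functions *)

Section PowerSeries.
Variable R : realType.
Local Notation C := (R[i]).
Implicit Types (F G : nat -> C) (l : C).

Lemma series_toD F G l l' : series_to F l -> series_to G l' ->
  series_to (fun i => F i + G i) (l + l').
Proof.
move=> HF HG e e0; have e2 : 0 < e / 2 by rewrite divr_gt0.
have [n1 H1] := HF _ e2; have [n2 H2] := HG _ e2.
exists (maxn n1 n2) => n; rewrite geq_max => /andP[/H1 h1 /H2 h2].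
rewrite big_split /= opprD addrACA (le_lt_trans (cmodD _ _)) // (splitr e).
exact: ltrD.
Qed.

Lemma series_toZ (k : C) F l : series_to F l -> series_to (fun i => k * F i) (k * l).
Proof.
move=> HF e e0; have k0 : 0 < cmod k + 1 by rewrite ltr_wpDl ?cmod_ge0.
have [n0 H] := HF _ (divr_gt0 e0 k0); exists n0 => n /H.
rewrite ltr_pdivlMr // => h; rewrite -mulr_sumr -mulrBr cmodM (le_lt_trans _ h) //.
by rewrite mulrC ler_wpM2l ?cmod_ge0 // lerDl.
Qed.

Lemma series_to_le F l (K : R) : series_to F l ->
  (forall n, cmod (\sum_(i < n) F i) <= K) -> cmod l <= K.
Proof.
move=> HF FK; apply/ler_addgt0Pr => e e0; have [n0 /(_ n0 (leqnn _)) H] := HF e e0.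
rewrite -[l](subrK (\sum_(i < n0) F i)) (le_trans (cmodD _ _)) // addrC lerD ?FK //.
exact: ltW.
Qed.

Lemma series_to_uniq F l l' : series_to F l -> series_to F l' -> l = l'.
Proof.
move=> H1 H2; apply/eqP; rewrite -subr_eq0; apply/eqP/(@eps_eq0 _ _ 2) => e e0.
have [n1 h1] := H1 e e0; have [n2 h2] := H2 e e0; pose n := maxn n1 n2.
have := h1 n (leq_maxl _ _); have := h2 n (leq_maxr _ _).
set S := \sum_(i < n) F i => a2 a1.
have -> : l - l' = (l - S) - (l' - S) by ring.
by rewrite (le_trans (cmodB _ _)) // mulr_natl mulr2n lerD // ltW.
Qed.

Lemma real_summable (u : nat -> R) (K : R) : (forall n, \sum_(i < n) `|u i| <= K) ->
  exists l : R, forall e : R, 0 < e -> exists n0, forall n, (n0 <= n)%N ->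
    `|l - \sum_(i < n) u i| < e.
Proof.
move=> uK; have : cvgn (series u).
  apply: normed_cvg; apply: nondecreasing_is_cvgn.
    by move=> n m nm; apply: (@nondecreasing_series _ (fun i => `|u i|) xpredT 0) => // i _ _; exact: normr_ge0.
  by exists K => _ [n _ <-]; have := uK n; rewrite -(big_mkord xpredT (fun i => `|u i|)).
move=> /cvg_ex[l /cvgrPdist_lt Hl]; exists l => e /Hl[n0 _ H].
by exists n0 => n /H; rewrite seriesEord.
Qed.

Lemma summable_series_to F (K : R) : (forall n, \sum_(i < n) cmod (F i) <= K) ->
  exists l, series_to F l.
Proof.
move=> FK.
have [n|lr Hr] := @real_summable (fun i => Re (F i)) K.
  by apply: le_trans (FK n); apply: ler_sum => i _; exact: Re_le_cmod.
have [n|li Hi] := @real_summable (fun i => Im (F i)) K.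
  by apply: le_trans (FK n); apply: ler_sum => i _; exact: Im_le_cmod.
exists (Complex lr li) => e e0; have e2 : 0 < e / 2 by rewrite divr_gt0.
have [n1 h1] := Hr _ e2; have [n2 h2] := Hi _ e2.
exists (maxn n1 n2) => n; rewrite geq_max => /andP[/h1 {}h1 /h2 {}h2].
have sR : Re (\sum_(i < n) F i) = \sum_(i < n) Re (F i).
  by elim/big_ind2: _ => // x1 y1 x2 y2 <- <-; rewrite ReD.
have sI : Im (\sum_(i < n) F i) = \sum_(i < n) Im (F i).
  by elim/big_ind2: _ => // x1 y1 x2 y2 <- <-; rewrite ImD.
rewrite (le_lt_trans (cmod_le_ReIm _)) // ReD ImD ReN ImN sR sI (splitr e).
exact: ltrD.
Qed.

Lemma sqr_le_4X n : (n%:R : R) ^+ 2 <= 4 ^+ n.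
Proof.
rewrite (_ : 4 = 2 ^+ 2 :> R); last by rewrite expr2 -natrM.
rewrite exprAC ler_pXn2r ?nnegrE ?exprn_ge0 ?ler0n //.
by rewrite -natrX ler_nat ltnW // ltn_expl.
Qed.

(** The constant [n^2] absorbs the binomial coefficients; inside a series it costs
only a factor 4 in the radius, by [sqr_le_4X]. *)
Lemma taylor2_pow (z h : C) (r : R) n : 1 <= r -> cmod z <= r -> cmod (z + h) <= r ->
  cmod ((z + h) ^+ n - z ^+ n - n%:R * z ^+ n.-1 * h) <= n%:R ^+ 2 * r ^+ n * cmod h ^+ 2.
Proof.
move=> r1 zr zhr; have r0 : 0 <= r := le_trans ler01 r1; elim: n => [|n IH].
  by rewrite !expr0 subrr !mul0r sub0r cmodN cmod0 expr0n /= !mul0r.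
have -> : (z + h) ^+ n.+1 - z ^+ n.+1 - n.+1%:R * z ^+ n.+1.-1 * h =
    (z + h) * ((z + h) ^+ n - z ^+ n - n%:R * z ^+ n.-1 * h) + n%:R * z ^+ n.-1 * h ^+ 2.
  case: n {IH} => [|n] /=; first by rewrite !expr0 !expr1; ring.
  by rewrite !exprS -!natr1; ring.
rewrite (le_trans (cmodD _ _)) //.
have B1 : cmod ((z + h) * ((z + h) ^+ n - z ^+ n - n%:R * z ^+ n.-1 * h)) <=
  r * (n%:R ^+ 2 * r ^+ n * cmod h ^+ 2) by rewrite cmodM ler_pM ?cmod_ge0.
have B2 : cmod (n%:R * z ^+ n.-1 * h ^+ 2) <= n%:R * r ^+ n.+1 * cmod h ^+ 2.
  rewrite cmodM cmodM !cmodX cmod_nat; apply: ler_wpM2r; first by rewrite exprn_ge0 ?cmod_ge0.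
  apply: ler_wpM2l; first exact: ler0n.
  apply: (@le_trans _ _ (r ^+ n.-1)); first by rewrite lerXn2r ?nnegrE ?cmod_ge0.
  by rewrite ler_weXn2l // (leq_trans (leq_pred _)).
apply: le_trans (lerD B1 B2) _.
have -> : r * (n%:R ^+ 2 * r ^+ n * cmod h ^+ 2) + n%:R * r ^+ n.+1 * cmod h ^+ 2 =
  (n%:R ^+ 2 + n%:R) * (r ^+ n.+1 * cmod h ^+ 2) by rewrite (exprS r n); ring.
rewrite -mulrA; apply: ler_wpM2r; first by rewrite mulr_ge0 ?exprn_ge0 ?cmod_ge0.
by rewrite -natr1; have := ler0n R n; set x := n%:R; nra.
Qed.

(** Termwise differentiation, with a remainder quadratic in [h].  The exponents form
an arbitrary sequence, as suits lacunary series. *)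
Theorem entire_series (b : nat -> C) (e : nat -> nat) (f : C -> C) :
  (forall r : R, 0 <= r -> exists K : R, forall n, \sum_(i < n) cmod (b i) * r ^+ e i <= K) ->
  (forall z, series_to (fun i => b i * z ^+ e i) (f z)) -> entire f.
Proof.
move=> Hb Hf; apply/entireP => z.
pose r := cmod z + 1; have r1 : 1 <= r by rewrite lerDr cmod_ge0.
have r0 : 0 <= r := le_trans ler01 r1.
have [K HK] := Hb (4 * r) (mulr_ge0 (ler0n _ _) r0).
have K0 : 0 <= K by have := HK 0%N; rewrite big_ord0.
have [D HD] : exists D, series_to (fun i => b i * ((e i)%:R * z ^+ (e i).-1)) D.
  apply: (@summable_series_to _ K) => n; apply: le_trans (HK n); apply: ler_sum => i _.
  rewrite !cmodM cmodX cmod_nat ler_wpM2l ?cmod_ge0 // exprMn ler_pM ?ler0n ?exprn_ge0 ?cmod_ge0 //.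
    apply: le_trans (sqr_le_4X _); case: (e i) => [|m]; first by rewrite expr0n.
    by rewrite expr2 ler_peMl // ler1n.
  apply: (@le_trans _ _ (r ^+ (e i).-1)).
    by rewrite lerXn2r ?nnegrE ?cmod_ge0 // /r lerDl.
  by rewrite ler_weXn2l // leq_pred.
apply: (@cdiff_little_o _ _ _ D) => eps eps0.
exists (Num.min 1 (eps / (K + 1))); first by rewrite lt_min ltr01 divr_gt0 // ltr_wpDl.
move=> h; rewrite lt_min ltr_pdivlMr ?ltr_wpDl // => /andP[h1 h2].
have S := series_toD (series_toD (Hf (z + h)) (series_toZ (-1) (Hf z))) (series_toZ (- h) HD).
have -> : f (z + h) - f z - D * h = f (z + h) + -1 * f z + - h * D by ring.
apply: (@le_trans _ _ (K * cmod h ^+ 2)); last first.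
  by rewrite expr2 mulrA ler_wpM2r ?cmod_ge0 //; have := cmod_ge0 h; nra.
apply: (series_to_le S) => n; apply: le_trans (cmod_sum _ _ _) _.
apply: (@le_trans _ _ (\sum_(i < n) (cmod (b i) * (4 * r) ^+ e i * cmod h ^+ 2))); last first.
  by rewrite -mulr_suml ler_wpM2r ?exprn_ge0 ?cmod_ge0.
apply: ler_sum => i _.
have -> : b i * (z + h) ^+ e i + -1 * (b i * z ^+ e i) + - h * (b i * ((e i)%:R * z ^+ (e i).-1)) =
  b i * ((z + h) ^+ e i - z ^+ e i - (e i)%:R * z ^+ (e i).-1 * h) by ring.
rewrite cmodM -[X in _ <= X]mulrA; apply: ler_wpM2l; first exact: cmod_ge0.
apply: le_trans (@taylor2_pow _ _ r _ r1 _ _) _; rewrite /r ?lerDl //.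
  by rewrite (le_trans (cmodD _ _)) // lerD2l ltW.
by rewrite exprMn ler_wpM2r ?exprn_ge0 ?cmod_ge0 // ler_wpM2r ?exprn_ge0 // sqr_le_4X.
Qed.

Lemma tcoef_le_circle (f : C -> C) n (r K : R) : entire f -> 0 < r ->
  (forall z, cmod z = r -> cmod (f z) <= K) -> cmod (tcoef f n) * r ^+ n <= 2 * K.
Proof. by move=> ef r0 fK; apply: tcoef_le => // t _; apply: fK; rewrite cmod_circle // ltW. Qed.

Lemma sum_geom (n : nat) : \sum_(i < n) (2^-1 : R) ^+ i <= 2.
Proof.
suff -> : \sum_(i < n) (2^-1 : R) ^+ i = 2 - 2 * 2^-1 ^+ n by rewrite gerBl mulr_ge0 ?exprn_ge0.
elim: n => [|n IH]; first by rewrite big_ord0 expr0 mulr1 subrr.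
by rewrite big_ord_recr /= IH exprS; field.
Qed.

Lemma entire_summable (f : C -> C) (r : R) : entire f -> 0 <= r ->
  exists K : R, forall n, \sum_(i < n) cmod (tcoef f i) * r ^+ i <= K.
Proof.
move=> ef r0; have /entireP df := ef.
pose s := 2 * (r + 1); have s0 : 0 < s by rewrite mulr_gt0 // ltr_wpDl.
have [K K0 HK] := @circle_bounded _ f s (fun t => cdiff_ccont (df _)).
exists (2 * K * 2) => n; apply: le_trans (ler_wpM2l _ (sum_geom n)); last by rewrite mulr_ge0.
rewrite mulr_sumr; apply: ler_sum => i _.
apply: (@le_trans _ _ (cmod (tcoef f i) * s ^+ i * 2^-1 ^+ i)); last first.
  by apply: ler_wpM2r; [rewrite exprn_ge0|exact: tcoef_le].
rewrite -[X in _ <= X]mulrA -exprMn; apply: ler_wpM2l; first exact: cmod_ge0.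
rewrite /s mulrAC divff // mul1r; apply: lerXn2r; rewrite ?nnegrE ?addr_ge0 //.
by rewrite lerDl.
Qed.

Lemma entire_bounded (f : C -> C) (r : R) : entire f -> 0 <= r ->
  exists2 K : R, 0 <= K & forall z, cmod z <= r -> cmod (f z) <= K.
Proof.
move=> ef r0; have [K HK] := entire_summable ef r0.
exists K => [|z zr]; first by have := HK 0%N; rewrite big_ord0.
apply: (series_to_le (taylor ef z)) => n; apply: le_trans (HK n).
apply: le_trans (cmod_sum _ _ _) _; apply: ler_sum => i _.
by rewrite cmodM cmodX ler_wpM2l ?cmod_ge0 // lerXn2r ?nnegrE ?cmod_ge0.
Qed.

Lemma series_to_finite F n l : (forall i, (n <= i)%N -> F i = 0) ->
  series_to F l -> l = \sum_(i < n) F i.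
Proof.
move=> F0 HF; apply: (series_to_uniq HF) => e e0; exists n => m nm.
rewrite -(subnKC nm) big_split_ord /= [X in _ - (_ + X)]big1 ?addr0 ?subrr ?cmod0 // => i _.
by rewrite F0 // leq_addr.
Qed.

(** Liouville for polynomial growth, assumed on arbitrarily large circles only. *)
Theorem entire_poly (q : C -> C) (N : nat) (K : R) : entire q ->
  (forall B : R, exists2 r : R, B < r & forall z, cmod z = r -> cmod (q z) <= K * r ^+ N) ->
  exists p : {poly C}, forall z, q z = p.[z].
Proof.
move=> eq_ H; exists (\poly_(i < N.+1) tcoef q i) => z.
rewrite horner_poly; apply: (@series_to_finite (fun i => tcoef q i * z ^+ i)) (taylor eq_ z).
move=> i Ni; suff -> : tcoef q i = 0 by rewrite mul0r.
apply: (@eps_eq0 _ _ (2 * `|K|)) => e e0.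
have [r rB Hr] := H (Num.max 1 e^-1).
have r1 : 1 <= r by apply/ltW; apply: le_lt_trans rB; rewrite le_max lexx.
have r0 : 0 < r := lt_le_trans ltr01 r1.
have re : r^-1 <= e.
  by rewrite invf_ple ?posrE //; apply/ltW; apply: le_lt_trans rB; rewrite le_max lexx orbT.
have := @tcoef_le_circle q i r _ eq_ r0 Hr.
rewrite -ler_pdivlMr ?exprn_gt0 // => /le_trans; apply.
rewrite -!mulrA ler_wpM2l //.
apply: (@le_trans _ _ (`|K| * r^-1)); last by rewrite ler_wpM2l.
apply: (@le_trans _ _ (`|K| * (r ^+ N / r ^+ i))).
  by rewrite ler_wpM2r ?ler_norm // divr_ge0 ?exprn_ge0 // ltW.
rewrite ler_wpM2l // ler_pdivrMr ?exprn_gt0 // mulrC ler_pdivlMr // -exprSr.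
exact: ler_weXn2l.
Qed.

Lemma entire_shift (f : C -> C) a : entire f -> entire (fun z => f (a + z)).
Proof.
move=> /entireP df; apply/entireP => z; apply: (@cdiff_comp _ f (fun w => a + w)) => //.
by apply: cdiffD; [exact: cdiff_cst|exact: cdiff_id].
Qed.

Lemma tcoef0 (f : C -> C) : entire f -> tcoef f 0 = f 0.
Proof.
move=> ef; have := @series_to_finite (fun i => tcoef f i * 0 ^+ i) 1 (f 0) _ (taylor ef 0).
by rewrite big_ord1 expr0 mulr1 => -> // -[|i] // _; rewrite expr0n mulr0.
Qed.

(** Cauchy's estimates make an entire function Lipschitz near a point, with a
constant governed by its size on a disc around that point. *)
Lemma entire_lipschitz (f : C -> C) (z h : C) (d M : R) : entire f -> 0 < d ->
  (forall w, cmod (w - z) <= d -> cmod (f w) <= M) -> cmod h <= d / 2 ->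
  cmod (f (z + h) - f z) <= 4 * M * cmod h / d.
Proof.
move=> ef d0 fM hd; pose g w := f (z + w); have eg : entire g by exact: entire_shift.
have gM n : cmod (tcoef g n) * d ^+ n <= 2 * M.
  apply: tcoef_le_circle => // w wd; apply: fM.
  by rewrite addrC addKr wd.
have M0 : 0 <= M by apply: le_trans (cmod_ge0 _) (fM z _); rewrite subrr cmod0 ltW.
have -> : f z = tcoef g 0 by rewrite tcoef0 // /g addr0.
have S : series_to (fun i => tcoef g i * h ^+ i + (if i == 0%N then - tcoef g 0 else 0)) (f (z + h) - tcoef g 0).
  apply: series_toD; first exact: taylor.
  move=> e e0; exists 1%N => -[//|n] _.
  by rewrite big_ord_recl /= big1 ?addr0 ?subrr ?cmod0.
apply: (series_to_le S) => n; apply: le_trans (cmod_sum _ _ _) _.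
pose x := cmod h / d; have x0 : 0 <= x by rewrite divr_ge0 ?cmod_ge0 // ltW.
have x2 : x <= 2^-1 by rewrite ler_pdivrMr // mulrC.
case: n => [|n]; first by rewrite big_ord0 divr_ge0 ?mulr_ge0 ?cmod_ge0 // ltW.
rewrite big_ord_recl /= expr0 mulr1 subrr cmod0 add0r.
apply: (@le_trans _ _ (\sum_(i < n) 2 * M * x * 2^-1 ^+ i)); last first.
  have h0 : 0 <= 2 * M * x by apply: mulr_ge0 => //; apply: mulr_ge0.
  rewrite -mulr_sumr; apply: le_trans (ler_wpM2l h0 (sum_geom n)) _.
  rewrite le_eqVlt; apply/orP; left; apply/eqP.
  by rewrite /x; field; rewrite gt_eqF.
apply: ler_sum => i _; rewrite /bump /= add1n addr0 cmodM cmodX.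
have -> : cmod h = x * d by rewrite /x divfK // gt_eqF.
rewrite exprMn mulrCA mulrC; apply: (@le_trans _ _ (2 * M * x ^+ i.+1)).
  by rewrite ler_wpM2r ?exprn_ge0.
rewrite exprS mulrA; apply: ler_wpM2l; last by rewrite lerXn2r ?nnegrE.
by apply: mulr_ge0 => //; apply: mulr_ge0.
Qed.

End PowerSeries.

(** * Zeros of entire functions *)

Section Zeros.
Variable R : realType.
Local Notation C := (R[i]).
Implicit Types (f g F G : C -> C) (a z w : C).

Lemma ccont_neq0 g a : ccont g a -> g a != 0 ->
  exists2 d : R, 0 < d & forall w, cmod (w - a) < d -> g w != 0.
Proof.
move=> cg ga; have g0 : 0 < cmod (g a) by rewrite cmod_gt0.
have [d d0 H] := cg _ g0; exists d => // w /H wa; apply: contraTneq wa => ->.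
by rewrite sub0r cmodN ltxx.
Qed.

(** The order is the index of the first nonzero Taylor coefficient at [a], and the
cofactor is the Taylor series with its indices shifted by that order. *)
Lemma zero_order_exists f a : entire f -> (exists z, f z != 0) -> exists m, zero_order f a m.
Proof.
move=> ef [z0 fz0]; pose F w := f (a + w); have eF : entire F := entire_shift ef.
have [n Hn] : exists n, tcoef F n != 0.
  apply: contrapT => H; move/eqP: fz0; apply.
  have -> : f z0 = F (z0 - a) by rewrite /F addrC subrK.
  have := @series_to_finite R _ 0 _ _ (taylor eF (z0 - a)).
  rewrite big_ord0; apply => i _.
  have [->|ci] := eqVneq (tcoef F i) 0; first by rewrite mul0r.
  by exfalso; apply: H; exists i.
have exn : exists n, tcoef F n != 0 by exists n.
case: (ex_minnP exn) => m cm minm {n Hn exn}.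
have Hsum (r : R) : 0 <= r -> exists K : R, forall n, \sum_(i < n) cmod (tcoef F (m + i)) * r ^+ i <= K.
  move=> r0; have r1 : 1 <= Num.max r 1 by rewrite le_max lexx orbT.
  have [K HK] := entire_summable eF (le_trans ler01 r1).
  exists K => n; apply: le_trans (HK (m + n)%N); rewrite big_split_ord /=.
  rewrite -[X in X <= _]add0r; apply: lerD.
    by apply: sumr_ge0 => i _; rewrite mulr_ge0 ?cmod_ge0 // exprn_ge0 // (le_trans ler01).
  apply: ler_sum => i _; apply: ler_wpM2l; first exact: cmod_ge0.
  apply: (@le_trans _ _ (Num.max r 1 ^+ i)).
    by apply: lerXn2r; rewrite ?nnegrE ?(le_trans ler01 r1) // le_max lexx.
  by apply: ler_weXn2l => //; rewrite leq_addl.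
have HG' w : exists l, series_to (fun i => tcoef F (m + i) * w ^+ i) l.
  have [K HK] := Hsum _ (cmod_ge0 w).
  apply: (@summable_series_to _ _ K) => n; apply: le_trans (HK n).
  by apply: ler_sum => i _; rewrite cmodM cmodX.
have [G HG] := choice HG'.
have eG : entire G := @entire_series R (fun i => tcoef F (m + i)) id G Hsum HG.
have FG w : F w = w ^+ m * G w.
  have S := series_toZ (w ^+ m) (HG w).
  apply: (series_to_uniq (taylor eF w)) => e e0; have [n0 Hn0] := S e e0.
  exists (m + n0)%N => n mn; have mn' : (m <= n)%N := leq_trans (leq_addr _ _) mn.
  rewrite -(subnKC mn') big_split_ord /= [X in _ - (X + _)]big1 ?add0r; last first.
    move=> i _; have [->|ci] := eqVneq (tcoef F i) 0; first by rewrite mul0r.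
    by have := minm _ ci; rewrite leqNgt ltn_ord.
  rewrite (eq_bigr (fun i : 'I_(n - m) => w ^+ m * (tcoef F (m + i) * w ^+ i))); last first.
    by move=> i _; rewrite exprD; ring.
  by apply: Hn0; rewrite leq_subRL.
exists m; exists (fun z => G (- a + z)); split; first exact: entire_shift.
  rewrite addNr; suff -> : G 0 = tcoef F m by [].
  have := @series_to_finite R _ 1 _ _ (HG 0).
  by rewrite big_ord1 expr0 mulr1 addn0; apply => -[|i] // _; rewrite expr0n mulr0.
move=> z; rewrite -[in f z](subrK a z) addrC -/(F (z - a)) FG.
by rewrite (addrC (- a)).
Qed.

Lemma zeros_isolated f a : entire f -> (exists z, f z != 0) ->
  exists2 d : R, 0 < d & forall w, w != a -> cmod (w - a) < d -> f w != 0.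
Proof.
move=> ef f0; have [m [g [/entireP eg ga fE]]] := zero_order_exists a ef f0.
have [d d0 H] := ccont_neq0 (cdiff_ccont (eg a)) ga.
exists d => // w wa /H gw; rewrite fE mulf_neq0 // expf_neq0 // subr_eq0 //.
Qed.

Lemma rat_approx (x e : R) : 0 < e -> exists q : rat, `|x - ratr q| < e.
Proof.
move=> e0; have xe : x < x + e by rewrite ltrDl.
have [q] := rat_in_itvoo xe; rewrite in_itv /= => /andP[h1 h2]; exists q.
by rewrite ltr_norml; apply/andP; split; lra.
Qed.

(** Zeros are isolated, so each is singled out among the zeros by a radius
[1 / (n + 1)] and a rational point close to it. *)
Lemma zeros_code f : entire f -> (exists z, f z != 0) ->
  exists code : C -> (nat * rat * rat), forall a b, f a = 0 -> f b = 0 -> code a = code b -> a = b.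
Proof.
move=> ef f0.
have Hc' a : exists c : nat * rat * rat,
    [/\ (forall w, w != a -> cmod (w - a) < c.1.1.+1%:R^-1 -> f w != 0),
      `|Re a - ratr c.1.2| < c.1.1.+1%:R^-1 / 4 & `|Im a - ratr c.2| < c.1.1.+1%:R^-1 / 4].
  have [d d0 H] := zeros_isolated a ef f0.
  have [n nd] : exists n : nat, n.+1%:R^-1 < d.
    exists (Num.truncn d^-1); rewrite invf_plt ?posrE ?ltr0n //; exact: truncnS_gt.
  have e0 : 0 < n.+1%:R^-1 / 4 :> R by rewrite divr_gt0 // invr_gt0 ltr0n.
  have [q1 Hq1] := rat_approx (Re a) e0; have [q2 Hq2] := rat_approx (Im a) e0.
  exists (n, q1, q2); split=> //= w wa wn; exact: H wa (lt_trans wn nd).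
have [code Hc] := choice Hc'; exists code => a b fa fb cab; apply/eqP; apply: contraT => nab.
have [Ha a1 a2] := Hc a; have [_ b1 b2] := Hc b; rewrite -cab in b1 b2.
have := Ha b; rewrite eq_sym => /(_ nab); rewrite fb eqxx; apply.
set e := _^-1 in a1 a2 b1 b2 *; have e0 : 0 < e by rewrite invr_gt0 ltr0n.
rewrite (le_lt_trans (cmod_le_ReIm _)) // ReD ImD ReN ImN.
move: a1 a2 b1 b2; rewrite !ltr_norml => /andP[? ?] /andP[? ?] /andP[? ?] /andP[? ?].
have h1 : `|Re b - Re a| < e / 2 by rewrite ltr_norml; apply/andP; split; lra.
have h2 : `|Im b - Im a| < e / 2 by rewrite ltr_norml; apply/andP; split; lra.
by rewrite (splitr e) ltrD.
Qed.

(** The sequence lists the pairs of a zero and a natural number below its order,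
at the position given by an injective code. *)
Theorem zeros_exactly_exists f : entire f -> (exists z, f z != 0) ->
  exists Z, zeros_exactly f Z.
Proof.
move=> ef f0.
have [m Hm] := choice (fun a => zero_order_exists a ef f0).
have [code codeI] := zeros_code ef f0.
have fm a : (0 < m a)%N -> f a = 0.
  by move=> ma; have [g [_ _ ->]] := Hm a; rewrite subrr expr0n gtn_eqF // mul0r.
pose tag (a : C) (i : nat) : nat := pickle (code a, i).
have tagI a b i j : (0 < m a)%N -> (0 < m b)%N -> tag a i = tag b j -> a = b /\ i = j.
  move=> ma mb /(pcan_inj (@pickleK _)) [cab ij]; split=> //.
  by apply: codeI => //; exact: fm.
pose P k a := exists2 i, (i < m a)%N & tag a i = k.
pose Z k := if pselect (exists a, P k a) is left H then Some (projT1 (cid H)) else None.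
exists Z => a; exists (m a) => //.
have -> : occ Z a = [set tag a i | i in `I_(m a)].
  apply/seteqP; split=> k.
    rewrite /occ /= /Z; case: pselect => // H [<-].
    by case: cid => b /= [i im <-]; exists i.
  move=> [i /= im <-]; rewrite /occ /= /Z; case: pselect => [H|[]]; last by exists a; exists i.
  congr Some; case: cid => b /= [j jm] tji.
  by have [] := tagI b a j i (leq_ltn_trans (leq0n _) jm) (leq_ltn_trans (leq0n _) im) tji.
apply: inj_card_eq => i j; rewrite !inE /= => im jm tij.
by have [] := tagI a a i j (leq_ltn_trans (leq0n _) im) (leq_ltn_trans (leq0n _) im) tij.
Qed.

(** At each point both functions are [(z - a)^m] times an entire cofactor, and the
quotient of the cofactors, which is defined near [a], extends [f / F] there. *)
Theorem entire_quotient f F : entire f -> entire F ->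
  (forall a, exists2 m, zero_order F a m & zero_order_ge f a m) ->
  exists2 q : C -> C, entire q & forall z, f z = q z * F z.
Proof.
move=> ef eF H.
have H' a : exists t : (C -> C) * (C -> C) * nat, [/\ entire t.1.1, entire t.1.2, t.1.2 a != 0,
   forall z, f z = (z - a) ^+ t.2 * t.1.1 z & forall z, F z = (z - a) ^+ t.2 * t.1.2 z].
  have [m [G [eG Ga FE]] [g eg fE]] := H a.
  by exists (g, G, m); split; [exact: eg|exact: eG|exact: Ga|exact: fE|exact: FE].
have [t Ht] := choice H'; pose q a := (t a).1.1 a / (t a).1.2 a.
exists q.
  apply/entireP => a; have [/entireP eg /entireP eG Ga fE FE] := Ht a.
  have [d d0 Hd] := ccont_neq0 (cdiff_ccont (eG a)) Ga.
  apply: (@cdiff_local _ (fun w => (t a).1.1 w * ((t a).1.2 w)^-1) _ _ d) => //.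
    move=> w wa; have Gw := Hd _ wa; rewrite /q.
    have [->//|nwa] := eqVneq w a.
    (* Away from [a] the function [F] does not vanish, so the order used at [w] is 0. *)
    have [_ _ Gw' fE' FE'] := Ht w.
    have wam : (w - a) ^+ (t a).2 != 0 by rewrite expf_neq0 // subr_eq0.
    have : F w != 0 by rewrite FE mulf_neq0.
    rewrite FE' subrr; case E : (t w).2 => [|n]; last by rewrite expr0n mul0r eqxx.
    rewrite expr0 mul1r => _; move: (fE w) (FE w); rewrite fE' FE' E expr0 !mul1r => -> ->.
    by field; rewrite Gw wam.
  by apply: cdiffM => //; exact: cdiffV.
move=> z; have [_ _ Gz fE FE] := Ht z; rewrite fE FE /q; field.
exact: Gz.
Qed.

End Zeros.

(** * A lacunary series that touches the Gaussian weight *)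

Section LacunarySeries.
Variable R : realType.
Local Notation C := (R[i]).
Variables (alpha : R) (M : nat).
Hypothesis alpha0 : 0 < alpha.

Lemma lerX (x y : R) n : 0 <= x -> x <= y -> x ^+ n <= y ^+ n.
Proof. by move=> x0 xy; apply: lerXn2r; rewrite ?nnegrE ?(le_trans x0). Qed.

(** The three bounds compare the term [(e x)^K] of the series with [exp (K x)]: it
is never larger, and it is smaller by a definite power of [e] when the ratio
[x] of the squared radii is at most 1/8 or at least 8. *)
Lemma expR1_tangent (x : R) : 0 <= x -> expR 1 * x <= expR x.
Proof.
move=> x0; have := expR_ge1Dx (x - 1); rewrite addrC subrK => h.
have -> : expR x = expR 1 * expR (x - 1) by rewrite -expRD addrC subrK.
by rewrite ler_wpM2l ?expR_ge0.
Qed.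

Lemma expR1_far_left (x : R) : 0 <= x -> x <= 8^-1 -> expR 1 * x <= expR (- 2^-1).
Proof.
move=> x0 x8; have h : expR (2^-1) <= 2 :> R.
  have := expR_ge1Dx (- 2^-1 : R); rewrite expRN.
  rewrite (_ : 1 + - 2^-1 = 2^-1 :> R); last by field.
  by rewrite lef_pV2 ?posrE ?expR_gt0.
have e3 : expR 1 * expR (2^-1) <= 8 :> R.
  have -> : expR 1 * expR (2^-1) = expR (2^-1) ^+ 3 :> R.
    by rewrite -expRM_natl -expRD; congr expR; field.
  rewrite (_ : 8 = 2 ^+ 3 :> R); last by rewrite !exprS expr0; ring.
  by apply: lerX; rewrite ?expR_ge0.
rewrite expRN -[X in _ <= X]mul1r ler_pdivlMr ?expR_gt0 //.
by rewrite mulrAC; have := mulr_ge0 (expR_ge0 (1 : R)) (expR_ge0 (2^-1 : R)); nra.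
Qed.

Lemma expR1_far_right (x : R) : 8 <= x -> expR 1 * x <= expR (x / 2).
Proof.
move=> x8; have -> : expR (x / 2) = expR 1 * expR ((x - 2) / 6) ^+ 3.
  by rewrite -expRM_natl -expRD; congr expR; field.
rewrite ler_wpM2l ?expR_ge0 //.
apply: (@le_trans _ _ (((x + 4) / 6) ^+ 3)).
  have s0 : 0 <= x - 8 by lra.
  have -> : ((x + 4) / 6) ^+ 3 = 8 + 2 * (x - 8) + (x - 8) ^+ 2 / 6 + (x - 8) ^+ 3 / 216 by field.
  have := exprn_ge0 2 s0; have := exprn_ge0 3 s0; lra.
rewrite lerXn2r ?nnegrE ?expR_ge0 //; first lra.
have := expR_ge1Dx ((x - 2) / 6); lra.
Qed.

(** [peak n] is half the value of [alpha |z|^2] at which the [n]-th term dominates;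
the exponents are lowered by [2 M] so that [|z|^(2 M)] times the [n]-th term is
the tangent monomial [2^-n (e x)^(peak n)], [x = alpha |z|^2 / (2 peak n)]. *)
Definition peak n : nat := ((M + 4) * 8 ^ n)%N.
Definition lexp n : nat := (2 * (peak n - M))%N.
Definition lcoef n : R := 2^-1 ^+ n * (alpha * expR 1 / (2 * (peak n)%:R)) ^+ peak n.

Lemma peak_gt0 n : (0 < peak n)%N.
Proof. by rewrite muln_gt0 expn_gt0 addn4. Qed.

Lemma lexpE n : (lexp n + 2 * M)%N = (2 * peak n)%N.
Proof.
rewrite /lexp -mulnDr subnK // /peak (leq_trans (leq_addr 4 M)) //.
by rewrite leq_pmulr // expn_gt0.
Qed.

Lemma lcoef_ge0 n : 0 <= lcoef n.
Proof.
by rewrite mulr_ge0 ?exprn_ge0 // divr_ge0 ?mulr_ge0 ?expR_ge0 ?(ltW alpha0).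
Qed.

Lemma lterm n (r : R) : lcoef n * r ^+ (2 * peak n) =
  2^-1 ^+ n * (expR 1 * (alpha * r ^+ 2 / (2 * (peak n)%:R))) ^+ peak n.
Proof.
rewrite /lcoef (exprM r 2); move: (peak n) => p.
rewrite -[LHS]mulrA; congr (_ * _); rewrite -exprMn; congr (_ ^+ _).
by rewrite -!mulrA; ring.
Qed.

(** Every term is tangent from below to the Gaussian growth [exp (alpha r^2 / 2)],
and touches it, up to the factor [2^-n], at the radius [alpha r^2 = 2 peak n]. *)
Lemma lterm_le n (r : R) : lcoef n * r ^+ (2 * peak n) <= 2^-1 ^+ n * expR (alpha / 2 * r ^+ 2).
Proof.
rewrite lterm; apply: ler_wpM2l; first by rewrite exprn_ge0.
have p0 : 0 < (peak n)%:R :> R by rewrite ltr0n peak_gt0.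
have x0 : 0 <= alpha * r ^+ 2 / (2 * (peak n)%:R).
  by apply: divr_ge0; apply: mulr_ge0; rewrite ?sqr_ge0 ?ler0n // ltW.
apply: (@le_trans _ _ (expR (alpha * r ^+ 2 / (2 * (peak n)%:R)) ^+ peak n)).
  by apply: lerX; [rewrite mulr_ge0 ?expR_ge0|exact: expR1_tangent].
rewrite -expRM_natl le_eqVlt; apply/orP; left; apply/eqP; congr expR.
by field; rewrite gt_eqF.
Qed.

Lemma peak_ratio m n : (m < n)%N -> (8 * (peak m)%:R : R) <= (peak n)%:R.
Proof.
move=> mn; rewrite -natrM ler_nat /peak mulnCA leq_pmul2l ?addn4 // -expnS.
by rewrite leq_pexp2l.
Qed.

(** At the radius of the [n]-th term all other terms are smaller by the factor
[exp (- peak n / 2)], because consecutive peaks have ratio 8. *)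
Lemma lterm_off n m (r : R) : m != n -> alpha * r ^+ 2 = 2 * (peak n)%:R ->
  lcoef m * r ^+ (2 * peak m) <= 2^-1 ^+ m * (expR (peak n)%:R * expR (- ((peak n)%:R / 2))).
Proof.
move=> mn rn; rewrite lterm rn; apply: ler_wpM2l; first by rewrite exprn_ge0.
have pm : 0 < (peak m)%:R :> R by rewrite ltr0n peak_gt0.
have pn : 0 < (peak n)%:R :> R by rewrite ltr0n peak_gt0.
have -> : 2 * (peak n)%:R / (2 * (peak m)%:R) = (peak n)%:R / (peak m)%:R :> R.
  by field; rewrite gt_eqF.
set y := _ / _; have y0 : 0 <= y by rewrite divr_ge0.
case: (ltngtP m n) mn => // [mn|nm] _.
  have y8 : 8 <= y by rewrite ler_pdivlMr // peak_ratio.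
  apply: (@le_trans _ _ (expR (y / 2) ^+ peak m)).
    by apply: lerX; [rewrite mulr_ge0 ?expR_ge0|exact: expR1_far_right].
  rewrite -expRM_natl -expRD le_eqVlt; apply/orP; left; apply/eqP; congr expR.
  by rewrite /y; field; rewrite gt_eqF.
have y8 : y <= 8^-1 by rewrite ler_pdivrMr // mulrC ler_pdivlMr // mulrC peak_ratio.
apply: (@le_trans _ _ (expR (- 2^-1) ^+ peak m)).
  by apply: lerX; [rewrite mulr_ge0 ?expR_ge0|exact: expR1_far_left].
rewrite -expRM_natl -expRD ler_expR; have := peak_ratio nm; lra.
Qed.

Lemma peak_decay n : expR (- ((peak n)%:R / 2)) <= 2^-1 ^+ n.+2 :> R.
Proof.
have e2 : expR (- 1) <= 2^-1 :> R.
  rewrite expRN lef_pV2 ?posrE ?expR_gt0 //; have := expR_ge1Dx (1 : R); lra.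
apply: (@le_trans _ _ (expR (- 1) ^+ n.+2)); last by apply: lerX; rewrite ?expR_ge0.
rewrite -expRM_natl ler_expR mulrN1 lerN2 ler_pdivlMr // -natrM ler_nat.
rewrite /peak; apply: (@leq_trans (4 * 8 ^ n)); last by rewrite leq_mul2r leq_addl orbT.
elim: n => // n IH; rewrite expnS; lia.
Qed.

Lemma sum_lterm_le n (r : R) : \sum_(i < n) lcoef i * r ^+ (2 * peak i) <= 2 * expR (alpha / 2 * r ^+ 2).
Proof.
apply: (@le_trans _ _ (\sum_(i < n) 2^-1 ^+ i * expR (alpha / 2 * r ^+ 2))).
  by apply: ler_sum => i _; exact: lterm_le.
by rewrite -mulr_suml ler_wpM2r ?expR_ge0 // sum_geom.
Qed.

Lemma lacunary_summable (r : R) : 0 <= r -> exists K : R, forall n,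
  \sum_(i < n) cmod ((lcoef i)%:C%C) * r ^+ lexp i <= K.
Proof.
move=> r0; pose s := Num.max r 1; have s1 : 1 <= s by rewrite le_max lexx orbT.
have s0 : 0 <= s := le_trans ler01 s1.
exists (2 * expR (alpha / 2 * s ^+ 2)) => n; apply: le_trans (sum_lterm_le n s).
apply: ler_sum => i _; rewrite cmod_real ger0_norm ?lcoef_ge0 //.
apply: ler_wpM2l; first exact: lcoef_ge0.
apply: (@le_trans _ _ (s ^+ lexp i)); first by apply: lerX => //; rewrite le_max lexx.
by apply: ler_weXn2l => //; rewrite -lexpE leq_addr.
Qed.

(** Up to polynomial factors, [P] has the largest growth that the weight allows, on
circles of arbitrarily large radius.  The loss [2^-n] of the dominating term is
paid for by the extra factor [r^2], since [2^n <= peak n]. *)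
Theorem lacunary_exists : exists P : C -> C, [/\ entire P,
  forall z, cmod z ^+ (2 * M) * cmod (P z) <= 2 * expR (alpha / 2 * cmod z ^+ 2) &
  forall B : R, exists2 r : R, B < r & forall z, cmod z = r ->
    expR (alpha / 2 * r ^+ 2) <= alpha * r ^+ (2 * M).+2 * cmod (P z)].
Proof.
have HP' z : exists l, series_to (fun i => (lcoef i)%:C%C * z ^+ lexp i) l.
  have [K HK] := lacunary_summable (cmod_ge0 z).
  apply: (@summable_series_to _ _ K) => n; apply: le_trans (HK n).
  by apply: ler_sum => i _; rewrite cmodM cmodX.
have [P HP] := choice HP'.
have S z : series_to (fun i => (lcoef i)%:C%C * z ^+ (2 * peak i)) (z ^+ (2 * M) * P z).
  have := series_toZ (z ^+ (2 * M)) (HP z); congr series_to; apply/funext => i.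
  by rewrite -lexpE exprD; ring.
have termE z i : cmod ((lcoef i)%:C%C * z ^+ (2 * peak i)) = lcoef i * cmod z ^+ (2 * peak i).
  by rewrite cmodM cmodX cmod_real ger0_norm ?lcoef_ge0.
exists P; split.
- exact: entire_series lacunary_summable HP.
- move=> z; rewrite -cmodX -cmodM; apply: (series_to_le (S z)) => n.
  apply: le_trans (cmod_sum _ _ _) _; apply: le_trans (sum_lterm_le n _).
  by apply: ler_sum => i _; rewrite termE.
move=> B; have [n Hn] : exists n, B ^+ 2 < 2 * (peak n)%:R / alpha.
  exists (Num.truncn (alpha * B ^+ 2)); rewrite ltr_pdivlMr // mulrC.
  set N := Num.truncn _; apply: (lt_le_trans (truncnS_gt _)); rewrite -/N -natrM ler_nat.
  rewrite /peak; apply: (leq_trans (@ltn_expl 8 N isT)).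
  by rewrite mulnA leq_pmull // muln_gt0 addn4.
pose r := Num.sqrt (2 * (peak n)%:R / alpha).
have p0 : 0 < (peak n)%:R :> R by rewrite ltr0n peak_gt0.
have q0 : 0 < 2 * (peak n)%:R / alpha by rewrite divr_gt0 ?mulr_gt0.
have r0 : 0 < r by rewrite sqrtr_gt0.
have r2 : r ^+ 2 = 2 * (peak n)%:R / alpha by rewrite sqr_sqrtr // ltW.
have ar2 : alpha * r ^+ 2 = 2 * (peak n)%:R by rewrite r2 mulrCA divff ?mulr1 // gt_eqF.
exists r.
  have [B0|B0] := ltP B 0; first exact: lt_trans r0.
  by rewrite -(ltr_pXn2r (n := 2)) ?nnegrE ?(ltW r0) // r2.
move=> z zr; set t := fun i => (lcoef i)%:C%C * z ^+ (2 * peak i).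
have S1 : series_to (fun i => t i + (if i == n then - t n else 0)) (z ^+ (2 * M) * P z + - t n).
  apply: series_toD; first exact: S.
  move=> e e0; exists n.+1 => m nm; rewrite -big_mkcond /=.
  by rewrite (big_pred1 (Ordinal nm)) ?subrr ?cmod0 // => i; rewrite -val_eqE.
have off : cmod (z ^+ (2 * M) * P z + - t n) <= 2^-1 * (2^-1 ^+ n * expR (peak n)%:R).
  apply: (series_to_le S1) => m; apply: le_trans (cmod_sum _ _ _) _.
  apply: (@le_trans _ _ (\sum_(i < m) 2^-1 ^+ i * (expR (peak n)%:R * 2^-1 ^+ n.+2))).
    apply: ler_sum => i _; have [->|ni] := eqVneq (i : nat) n.
      by rewrite subrr cmod0; apply: mulr_ge0; [|apply: mulr_ge0]; rewrite ?exprn_ge0 ?expR_ge0.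
    rewrite addr0 termE zr; apply: le_trans (lterm_off ni ar2) _.
    apply: ler_wpM2l; first by rewrite exprn_ge0.
    by apply: ler_wpM2l; [exact: expR_ge0|exact: peak_decay].
  rewrite -mulr_suml; apply: le_trans (ler_wpM2r _ (sum_geom R m)) _.
    by rewrite mulr_ge0 ?exprn_ge0 ?expR_ge0.
  by rewrite !exprS le_eqVlt; apply/orP; left; apply/eqP; field.
have main : cmod (t n) = 2^-1 ^+ n * expR (peak n)%:R.
  rewrite termE zr lterm ar2 divff ?mulr1; last by rewrite mulf_neq0 // gt_eqF.
  by rewrite -expRM_natl mulr1.
have low : 2^-1 * (2^-1 ^+ n * expR (peak n)%:R) <= cmod z ^+ (2 * M) * cmod (P z).
  rewrite -cmodX -cmodM; have := cmod_subl (t n) (z ^+ (2 * M) * P z).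
  by rewrite cmod_subC main; lra.
have -> : alpha / 2 * r ^+ 2 = (peak n)%:R by rewrite mulrAC ar2 mulrAC divff ?mul1r.
have -> : alpha * r ^+ (2 * M).+2 * cmod (P z) = 2 * (peak n)%:R * (r ^+ (2 * M) * cmod (P z)).
  by rewrite -ar2 -addn2 exprD; ring.
rewrite zr in low; apply: le_trans (ler_wpM2l _ low); last by rewrite mulr_ge0 ?ler0n.
rewrite !mulrA ler_peMl ?expR_ge0 //.
rewrite (_ : 2 * (peak n)%:R / 2 * 2^-1 ^+ n = (peak n)%:R / 2 ^+ n :> R); last first.
  by rewrite exprVn; field; rewrite expf_neq0.
rewrite ler_pdivlMr ?exprn_gt0 // mul1r -natrX ler_nat /peak.
apply: (@leq_trans (8 ^ n)); last by rewrite leq_pmull // addn4.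
by case: (n) => [//|k]; rewrite leq_exp2r.
Qed.

End LacunarySeries.

(** * Measure on the plane *)

Section PlaneMeasure.
Variable R : realType.
Local Notation C := (R[i]).
Notation mu := (@lebesgue_measure R).
Local Notation area := (mu \x mu)%E.

Definition box (x y e : R) : set (R * R) := `]x - e, x + e[ `*` `]y - e, y + e[.

Lemma measurable_box x y e : measurable (box x y e).
Proof. by apply: measurableX; exact: measurable_itv. Qed.

(** A function continuous in both variables jointly is measurable for the
product of the two Borel structures: its superlevel sets are countable unions of rational boxes. *)
Lemma plane_measurable (g : R * R -> R) :
  (forall x y (e : R), 0 < e -> exists2 d : R, 0 < d & forall x' y',
     `|x' - x| < d -> `|y' - y| < d -> `|g (x', y') - g (x, y)| < e) ->
  measurable_fun [set: R * R] g.
Proof.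
move=> cg; apply: (measurability _ (RGenOInfty.measurableE R)).
move=> /= _ [_ [a ->] <-]; rewrite setTI.
pose F (t : rat * rat * nat) : set (R * R) :=
  let b := box (ratr t.1.1) (ratr t.1.2) t.2.+1%:R^-1 in
  if `[< b `<=` g @^-1` `]a, +oo[%classic >] then b else set0.
suff -> : g @^-1` `]a, +oo[%classic = \bigcup_t F t.
  apply: countable_bigcupT_measurable => [|t]; first exact: countableP.
  by rewrite /F; case: asboolP => // _; exact: measurable_box.
apply/seteqP; split => [[x y] /=|[x y] [t _]]; last first.
  by rewrite /F; case: asboolP => // H; exact: H.
rewrite in_itv /= andbT => ag; have e0 : 0 < g (x, y) - a by rewrite subr_gt0.
have [d d0 Hd] := cg x y _ e0.
have [n nd] : exists n : nat, n.+1%:R^-1 < d / 2.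
  exists (Num.truncn (d / 2)^-1); rewrite invf_plt ?posrE ?ltr0n ?divr_gt0 //; exact: truncnS_gt.
have n0 : 0 < n.+1%:R^-1 :> R by rewrite invr_gt0 ltr0n.
have [q1 H1] := rat_approx x n0; have [q2 H2] := rat_approx y n0.
exists (q1, q2, n) => //; rewrite /F; case: asboolP => [_|[]].
  by rewrite /box /= !in_itv /= -!ltr_distlC; split; rewrite distrC.
move=> [x' y']; rewrite /box /= !in_itv /= -!ltr_distlC => -[h1 h2].
have k1 : `|x' - x| < d.
  rewrite (_ : x' - x = - (ratr q1 - x') - (x - ratr q1)); last by ring.
  apply: le_lt_trans (ler_normB _ _) _; rewrite normrN (splitr d).
  by apply: ltrD; exact: lt_trans nd.
have k2 : `|y' - y| < d.
  rewrite (_ : y' - y = - (ratr q2 - y') - (y - ratr q2)); last by ring.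
  apply: le_lt_trans (ler_normB _ _) _; rewrite normrN (splitr d).
  by apply: ltrD; exact: lt_trans nd.
have := Hd _ _ k1 k2; rewrite andbT ltr_norml => /andP[? _]; lra.
Qed.

Lemma measurable_cmod_plane (f : C -> C) : (forall z, ccont f z) ->
  measurable_fun [set: R * R] (fun w => cmod (f (Complex w.1 w.2))).
Proof.
move=> cf; apply: plane_measurable => x y e e0.
have [d d0 Hd] := cf (Complex x y) e e0; exists (d / 2); first by rewrite divr_gt0.
move=> x' y' hx hy; apply: le_lt_trans (cmod_dist _ _) _; apply: Hd.
by rewrite (le_lt_trans (cmod_le_ReIm _)) //= (splitr d) ltrD.
Qed.

Lemma measurable_weighted alpha (f : C -> C) (r : R) : entire f ->
  measurable_fun [set: R * R] (fun w => weighted alpha f (Complex w.1 w.2) `^ r).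
Proof.
move=> /entireP df.
apply: (measurableT_comp (f := fun x : R => x `^ r)); first exact: measurable_powR.
apply: measurable_funM; first by apply: measurable_cmod_plane => z; exact: cdiff_ccont.
apply: measurableT_comp => //; apply: measurable_funM => //.
apply: measurable_funX; apply: (@measurable_cmod_plane id) => z; exact: ccont_id.
Qed.

Lemma integral_oneDsqrV : (\int[mu]_x ((oneDsqr x)^-1)%:E)%E = (pi)%:E :> \bar R.
Proof.
rewrite ge0_symfun_integralT.
- rewrite (_ : [set x | _] = `[0%R, +oo[%classic); last first.
    by apply/seteqP; split=> x /=; rewrite in_itv /= ?andbT.
  by rewrite integral0y_oneDsqr -EFinM mulrC divfK.
- by move=> x; rewrite invr_ge0 (le_trans ler01) // oneDsqr_ge1.
- exact: continuous_oneDsqrV.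
- by move=> x; rewrite /= /oneDsqr sqrrN.
Qed.

Definition cauchy_kernel (w : R * R) : R := (oneDsqr w.1)^-1 * (oneDsqr w.2)^-1.

Lemma oneDsqrV_ge0 (x : R) : 0 <= (oneDsqr x)^-1.
Proof. by rewrite invr_ge0 (le_trans ler01) // oneDsqr_ge1. Qed.

Lemma measurable_oneDsqrV : measurable_fun [set: R] (fun x : R => (oneDsqr x)^-1).
Proof. by apply: continuous_measurable_fun; exact: continuous_oneDsqrV. Qed.

Lemma measurable_cauchy_kernel : measurable_fun [set: R * R] cauchy_kernel.
Proof.
apply: measurable_funM.
  exact: (measurableT_comp measurable_oneDsqrV measurable_fst).
exact: (measurableT_comp measurable_oneDsqrV measurable_snd).
Qed.

Lemma integral_cauchy_kernel : (\int[area]_w (cauchy_kernel w)%:E = (pi ^+ 2)%:E)%E.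
Proof.
rewrite fubini_tonelli1; last 2 first.
- by apply/measurable_EFinP; exact: measurable_cauchy_kernel.
- by move=> w; rewrite lee_fin mulr_ge0 ?oneDsqrV_ge0.
transitivity (\int[mu]_x (pi%:E * ((oneDsqr x)^-1)%:E))%E.
  apply: eq_integral => x _; rewrite /fubini_F /cauchy_kernel /=.
  under eq_integral do rewrite EFinM.
  rewrite ge0_integralZl //; first by rewrite integral_oneDsqrV muleC.
  - by apply/measurable_EFinP; exact: measurable_oneDsqrV.
rewrite ge0_integralZl //; first by rewrite integral_oneDsqrV -EFinM.
- by apply/measurable_EFinP; exact: measurable_oneDsqrV.
- by rewrite lee_fin pi_ge0.
Qed.

End PlaneMeasure.

(** * Membership in the Fock spaces *)

Section FockSpaces.
Variable R : realType.
Local Notation C := (R[i]).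
Notation mu := (@lebesgue_measure R).
Local Notation area := (mu \x mu)%E.
Variable alpha : R.
Hypothesis alpha0 : 0 < alpha.
Implicit Types (f g h : C -> C) (z w : C) (r : R).

Lemma weighted_ge0 f z : 0 <= weighted alpha f z.
Proof. by rewrite mulr_ge0 ?cmod_ge0 ?expR_ge0. Qed.

Lemma weighted_le f z (K : R) :
  (weighted alpha f z <= K) = (cmod (f z) <= K * expR (alpha / 2 * cmod z ^+ 2)).
Proof. by rewrite /weighted mulNr expRN ler_pdivrMr ?expR_gt0. Qed.

Lemma pos_erealP (p : \bar R) : (0 < p)%E -> (exists2 r, 0 < r & p = r%:E) \/ p = +oo%E.
Proof. by case: p => [r| |] // p0; [left; exists r|right]. Qed.

Lemma fock_finE r f : fock_space r%:E alpha f <-> entire f /\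
  (\int[area]_w (weighted alpha f (Complex w.1 w.2) `^ r)%:E < +oo)%E.
Proof.
have I0 : (0 <= \int[area]_w (weighted alpha f (Complex w.1 w.2) `^ r)%:E)%E.
  by apply: integral_ge0 => w _; rewrite lee_fin powR_ge0.
have p0 : 0 < alpha / pi by rewrite divr_gt0 // pi_gt0.
rewrite /fock_space /=; split=> -[ef]; move: I0; case: (integral _ _ _) => [x| |] //= x0.
- by move=> _; rewrite ltry.
- by rewrite mulry gtr0_sg // mul1e.
- by move=> _; rewrite -EFinM ltry.
Qed.

Lemma fock_infE f : fock_space +oo%E alpha f <-> entire f /\
  exists K : R, forall z, weighted alpha f z <= K.
Proof.
rewrite /fock_space /=; split=> -[ef]; [move=> H|move=> [K HK]]; split=> //.
  move: H; case E : (ereal_sup _) => [K| |] // _.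
    exists K => z; rewrite -lee_fin -E; apply: ereal_sup_ubound; exists z => //.
  exists 0 => z; have : ((weighted alpha f z)%:E <= -oo)%E.
    by rewrite -E; apply: ereal_sup_ubound; exists z.
  by rewrite leeNy_eq.
apply: (@le_lt_trans _ _ K%:E); last exact: ltry.
by apply: ge_ereal_sup => _ [z _ <-]; rewrite lee_fin.
Qed.

Lemma fock_entire p f : fock_space p alpha f -> entire f.
Proof. by case. Qed.

(** Decay [(1 + |z|^2)^-s] beyond the Gaussian weight is [p]-integrable over the
plane once [s p >= 2], by comparison with a product of two Cauchy densities. *)
Theorem fock_of_decay (p : \bar R) f (s : nat) (K : R) : (0 < p)%E -> entire f ->
  (forall r, p = r%:E -> 2 <= s%:R * r) ->
  (forall z, cmod (f z) * (1 + cmod z ^+ 2) ^+ s <= K * expR (alpha / 2 * cmod z ^+ 2)) ->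
  fock_space p alpha f.
Proof.
move=> p0 ef Hs HK.
have D1 z : 1 <= 1 + cmod z ^+ 2 by rewrite lerDl sqr_ge0.
have D0 z : 0 < 1 + cmod z ^+ 2 := lt_le_trans ltr01 (D1 z).
have HW z : weighted alpha f z * (1 + cmod z ^+ 2) ^+ s <= K.
  by rewrite /weighted mulrAC mulNr expRN ler_pdivrMr ?expR_gt0.
case: p p0 Hs => [r| |] // p0 Hs; last first.
  apply/fock_infE; split=> //; exists K => z; apply: le_trans (HW z).
  by rewrite ler_peMr ?weighted_ge0 // exprn_ege1.
rewrite lte_fin in p0; apply/fock_finE; split=> //; have {}Hs := Hs r erefl.
have K0 : 0 <= K by apply: le_trans (HW 0); rewrite mulr_ge0 ?weighted_ge0 ?exprn_ge0 // ltW.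
apply: (@le_lt_trans _ _ (\int[area]_w ((K `^ r)%:E * (cauchy_kernel w)%:E))%E).
  apply: ge0_le_integral => //.
  - by move=> w _; rewrite lee_fin powR_ge0.
  - by apply/measurable_EFinP; exact: measurable_weighted.
  - apply: emeasurable_funM; first exact: measurable_cst.
    by apply/measurable_EFinP; exact: measurable_cauchy_kernel.
  move=> [x y] _ /=; rewrite -EFinM lee_fin /cauchy_kernel /=.
  set z := Complex x y; rewrite -invfM ler_pdivlMr; last first.
    by rewrite mulr_gt0 ?(lt_le_trans ltr01) ?oneDsqr_ge1.
  apply: (@le_trans _ _ (weighted alpha f z `^ r * ((1 + cmod z ^+ 2) ^+ s) `^ r)).
    rewrite ler_wpM2l ?powR_ge0 //.
    rewrite -powR_mulrn ?(ltW (D0 z)) // -powRrM.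
    apply: (@le_trans _ _ ((1 + cmod z ^+ 2) `^ 2%:R)); last exact: ler_powR.
    rewrite powR_mulrn ?(ltW (D0 z)) // expr2 cmod_sqr /= /oneDsqr.
    by rewrite ler_pM ?addr_ge0 ?sqr_ge0 // lerD2l ?lerDl ?lerDr sqr_ge0.
  rewrite -powRM ?weighted_ge0 ?exprn_ge0 ?(ltW (D0 z)) //.
  apply: ge0_ler_powR; [exact: ltW| |by rewrite nnegrE|exact: HW].
  by rewrite nnegrE; apply: mulr_ge0; [exact: weighted_ge0|rewrite exprn_ge0 // ltW].
rewrite ge0_integralZl //.
- by rewrite integral_cauchy_kernel -EFinM ltry.
- by apply/measurable_EFinP; exact: measurable_cauchy_kernel.
- by move=> w _; rewrite lee_fin mulr_ge0 ?oneDsqrV_ge0.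
- by rewrite lee_fin powR_ge0.
Qed.

(** The set [F^p] is not a normed space for [p < 1], but [(a + b)^r] is always at
most [2^r (a^r + b^r)]. *)
Theorem fock_dominated (p : \bar R) f g h (K : R) : (0 < p)%E -> 0 <= K ->
  fock_space p alpha f -> fock_space p alpha g -> entire h ->
  (forall z, cmod (h z) <= K * (cmod (f z) + cmod (g z))) -> fock_space p alpha h.
Proof.
move=> p0 K0 Ff Fg eh H.
have HW z : weighted alpha h z <= K * (weighted alpha f z + weighted alpha g z).
  by rewrite /weighted -mulrDl mulrA ler_wpM2r ?expR_ge0.
have [[r r0 pE]|pE] := pos_erealP p0; rewrite {}pE {p p0} in Ff Fg *; last first.
  have [_ [A HA]] := (fock_infE f).1 Ff; have [_ [B HB]] := (fock_infE g).1 Fg.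
  apply/fock_infE; split; first exact: eh.
  by exists (K * (A + B)) => z; apply: le_trans (HW z) _; rewrite ler_wpM2l // lerD.
have [ef If] := (fock_finE r f).1 Ff; have [eg Ig] := (fock_finE r g).1 Fg.
apply/fock_finE; split; first exact: eh.
set c := ((2 * K) `^ r)%:E; have c0 : (0 <= c)%E by rewrite lee_fin powR_ge0.
apply: (@le_lt_trans _ _ (\int[area]_w (c * ((weighted alpha f (Complex w.1 w.2) `^ r)%:E
    + (weighted alpha g (Complex w.1 w.2) `^ r)%:E)))%E).
  apply: ge0_le_integral => //.
  - by move=> w _; rewrite lee_fin powR_ge0.
  - by apply/measurable_EFinP; exact: measurable_weighted.
  - apply: emeasurable_funM; first exact: measurable_cst.
    by apply: emeasurable_funD; apply/measurable_EFinP; exact: measurable_weighted.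
  move=> w _; rewrite -EFinD -EFinM lee_fin; set z := Complex _ _.
  have a0 := weighted_ge0 f z; have b0 := weighted_ge0 g z.
  set a := weighted alpha f z in a0 *; set b := weighted alpha g z in b0 *.
  have m0 : 0 <= Num.max a b by rewrite le_max a0.
  apply: (@le_trans _ _ ((2 * K * Num.max a b) `^ r)).
    apply: ge0_ler_powR; [exact: ltW|by rewrite nnegrE weighted_ge0| |].
      by rewrite nnegrE; apply: mulr_ge0 => //; apply: mulr_ge0.
    apply: le_trans (HW z) _; rewrite (mulrC 2) -mulrA ler_wpM2l // mulr_natl mulr2n.
    by rewrite lerD // le_max lexx ?orbT.
  rewrite powRM ?mulr_ge0 // ler_wpM2l ?powR_ge0 //.
  by rewrite /Num.max; case: ifP => _; rewrite ?lerDl ?lerDr powR_ge0.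
rewrite ge0_integralZl //; last 2 first.
- by apply: emeasurable_funD; apply/measurable_EFinP; exact: measurable_weighted.
- by move=> w _; rewrite adde_ge0 // lee_fin powR_ge0.
rewrite ge0_integralD //; try (by apply/measurable_EFinP; exact: measurable_weighted); try by move=> w _; rewrite lee_fin powR_ge0.
apply: lte_mul_pinfty; [exact: c0|exact: isT|].
by apply: lte_add_pinfty; [exact: If|exact: Ig].
Qed.

End FockSpaces.

(** * Pointwise growth in the Fock spaces *)

Section PointwiseBound.
Variable R : realType.
Local Notation C := (R[i]).
Notation mu := (@lebesgue_measure R).
Local Notation area := (mu \x mu)%E.
Variable alpha : R.
Hypothesis alpha0 : 0 < alpha.
Implicit Types (f : C -> C) (z w : C) (r d : R).

Definition square (z : C) (e : R) : set (R * R) :=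
  `[Re z, Re z + e] `*` `[Im z, Im z + e].

Lemma area_square z (e : R) : 0 <= e -> area (square z e) = (e ^+ 2)%:E.
Proof.
move=> e0; rewrite /square product_measure1E; [|exact: measurable_itv..].
have len (x : R) : mu `[x, x + e]%classic = e%:E.
  rewrite lebesgue_measure_itv /= lte_fin ltrDl; case: ltP => [_|e1].
    by rewrite -EFinB addrAC subrr add0r.
  by rewrite (le_anti (_ : e <= 0 <= e)) // e1.
transitivity (e%:E * e%:E)%E; last by rewrite -EFinM expr2.
exact: (congr2 mule (len (Re z)) (len (Im z))).
Qed.

Lemma square_dist z (e : R) (w : R * R) : square z e w ->
  cmod (Complex w.1 w.2 - z) <= 2 * e.
Proof.
case: w => x y [/=]; rewrite !in_itv /= => /andP[h1 h2] /andP[h3 h4].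
apply: le_trans (cmod_le_ReIm _) _; rewrite ReD ImD ReN ImN /= mulr_natl mulr2n.
by rewrite lerD // ger0_norm ?subr_ge0 // lerBlDl.
Qed.

Lemma integral_square_le f z (e r c : R) : entire f -> 0 <= e -> 0 <= c ->
  (forall w : R * R, square z e w -> c <= weighted alpha f (Complex w.1 w.2) `^ r) ->
  ((c * e ^+ 2)%:E <= \int[area]_w (weighted alpha f (Complex w.1 w.2) `^ r)%:E)%E.
Proof.
move=> ef e0 c0 H; have mS : measurable (square z e).
  by apply: measurableX; exact: measurable_itv.
have -> : ((c * e ^+ 2)%:E = \int[area]_w (c%:E * (\1_(square z e) w)%:E))%E.
  rewrite ge0_integralZl //.
  - transitivity (c%:E * (e ^+ 2)%:E)%E; first by rewrite EFinM.
    congr (_ * _)%E; rewrite integral_indic // setIT; exact/esym/area_square.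
  - by apply/measurable_EFinP; exact: measurable_indic.
apply: ge0_le_integral => //.
- by move=> w _; rewrite -EFinM lee_fin mulr_ge0.
- apply: emeasurable_funM; first exact: measurable_cst.
  by apply/measurable_EFinP; exact: measurable_indic.
- by apply/measurable_EFinP; exact: measurable_weighted.
move=> w _; rewrite -EFinM lee_fin indicE.
case: (boolP (w \in square z e)) => [|_]; last by rewrite mulr0 powR_ge0.
by rewrite inE mulr1 => /H.
Qed.

(** Almost maximising [|f w| (d - |w - z|)^(N + 1)] over the disc gives a point near
which [f] keeps half of its modulus, by the Lipschitz bound.  This does the work
of the subharmonicity of [|f|^p] and treats all [p > 0] alike. *)
Lemma near_extremal f z d N : entire f -> 0 < d -> f z != 0 ->
  exists z0 rho, [/\ cmod (z0 - z) + rho <= d, 0 < rho,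
     cmod (f z) * d ^+ N.+1 <= 2 * (cmod (f z0) * rho ^+ N.+1) &
     forall h, cmod h <= rho / (32 * 2 ^+ N.+1) -> cmod (f z0) / 2 <= cmod (f (z0 + h))].
Proof.
move=> ef d0 fz.
pose phi w := cmod (f w) * (d - cmod (w - z)) ^+ N.+1.
pose E := [set phi w | w in [set w | cmod (w - z) <= d]].
have [K K0 HK] := entire_bounded (entire_shift (a := z) ef) (ltW d0).
have phiz : phi z = cmod (f z) * d ^+ N.+1 by rewrite /phi subrr cmod0 subr0.
have phiz0 : 0 < phi z by rewrite phiz mulr_gt0 ?exprn_gt0 ?cmod_gt0.
have hE : has_sup E.
  split; first by exists (phi z); exists z => //=; rewrite subrr cmod0 ltW.
  exists (K * d ^+ N.+1) => _ [w /= wd <-]; apply: ler_pM; rewrite ?cmod_ge0 ?exprn_ge0 ?subr_ge0 //.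
    by have := HK (w - z) wd; rewrite addrC subrK.
  by apply: lerX; rewrite ?subr_ge0 // gerBl cmod_ge0.
have supE w : cmod (w - z) <= d -> phi w <= sup E.
  by move=> wd; apply: ub_le_sup; [exact: hE.2|exists w].
have S0 : 0 < sup E.
  by apply: (lt_le_trans phiz0); apply: supE; rewrite subrr cmod0 ltW.
have [_ [z0 /= z0d <-] Hz0] := sup_adherent (divr_gt0 S0 (ltr0Sn R 1)) hE.
have {}Hz0 : sup E <= 2 * phi z0 by move: Hz0; clear; move: (sup E) (phi z0) => u v; lra.
have phiz00 : 0 < phi z0 by move: Hz0 S0; clear; move: (sup E) (phi z0) => u v; lra.
pose rho := d - cmod (z0 - z).
have rho0 : 0 < rho.
  rewrite lt_neqAle subr_ge0 z0d andbT; apply: contraTneq phiz00 => r0.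
  by rewrite /phi -/rho -r0 expr0n mulr0 ltxx.
have n0 : 2 ^+ N.+1 != 0 :> R by rewrite expf_neq0.
have p0 : 0 < 2 ^+ N.+1 :> R by rewrite exprn_gt0.
have p1 : 1 <= 2 ^+ N.+1 :> R by rewrite exprn_ege1 // ler1n.
exists z0, rho; split => //.
- by rewrite /rho addrC subrK.
- rewrite -phiz -/(phi z0); apply: le_trans Hz0.
  by apply: supE; rewrite subrr cmod0 ltW.
have Mx w : cmod (w - z0) <= rho / 2 -> cmod (f w) <= 2 * 2 ^+ N.+1 * cmod (f z0).
  move=> wr; have wz : cmod (w - z) <= cmod (z0 - z) + rho / 2.
    have -> : w - z = (z0 - z) + (w - z0) by ring.
    by apply: le_trans (cmodD _ _) _; rewrite lerD2l.
  have wd : cmod (w - z) <= d by apply: le_trans wz _; rewrite /rho; move: rho0; rewrite /rho; lra.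
  have r2 : rho / 2 <= d - cmod (w - z) by move: wz; rewrite /rho; lra.
  have h1 := le_trans (supE w wd) Hz0.
  have h2 : cmod (f w) * (rho / 2) ^+ N.+1 <= 2 * (cmod (f z0) * rho ^+ N.+1).
    apply: le_trans h1; apply: ler_wpM2l; first exact: cmod_ge0.
    by apply: lerX => //; rewrite divr_ge0 // ltW.
  have q0 : 0 < (rho / 2) ^+ N.+1 by rewrite exprn_gt0 // divr_gt0.
  rewrite -(ler_pM2r q0); apply: le_trans h2 _; rewrite expr_div_n le_eqVlt.
  by apply/orP; left; apply/eqP; field.
move=> h hr; have hrho : 0 <= rho / 2 by rewrite divr_ge0 // ltW.
have h4 : cmod h <= rho / 2 / 2.
  apply: le_trans hr _; rewrite -mulrA ler_wpM2l ?(ltW rho0) // -invfM lef_pV2 ?posrE ?mulr_gt0 //.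
  lra.
have := entire_lipschitz ef (divr_gt0 rho0 (ltr0Sn R 1)) Mx h4.
have -> : 4 * (2 * 2 ^+ N.+1 * cmod (f z0)) * cmod h / (rho / 2) =
   (cmod (f z0) / 2) * (cmod h / (rho / (32 * 2 ^+ N.+1))).
  by field; rewrite n0 gt_eqF.
have hq : cmod h / (rho / (32 * 2 ^+ N.+1)) <= 1.
  by rewrite ler_pdivrMr ?mul1r // divr_gt0 // mulr_gt0.
have c2 : 0 <= cmod (f z0) / 2 by rewrite divr_ge0 ?cmod_ge0.
move=> /le_trans/(_ (ler_wpM2l c2 hq)); rewrite mulr1.
have := cmod_subl (f z0) (f (z0 + h)); rewrite cmod_subC.
by move: (cmod _) (cmod _) (cmod _) => a b c; lra.
Qed.

(** Apply [near_extremal] on the disc of radius [1 / (1 + |z|)], where the weight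
varies by a bounded factor, and integrate over a square near the extremal point;
the choice [(N + 1) r >= 2] makes the area of that square dominate the power of
its side.  The exponent [n] depends on [p] only. *)
Theorem fock_pointwise (p : \bar R) : (0 < p)%E -> exists n : nat, forall f,
  fock_space p alpha f -> exists2 K : R, 0 <= K &
    forall z, cmod (f z) <= K * (1 + cmod z) ^+ n * expR (alpha / 2 * cmod z ^+ 2).
Proof.
move=> p0; have [[r r0 pE]|pE] := pos_erealP p0; rewrite {}pE {p p0}; last first.
  exists 0%N => f /fock_infE[_ [K HK]]; exists `|K| => // z.
  rewrite expr0 mulr1 -weighted_le; apply: le_trans (HK z) (ler_norm K).
have [N HN] : exists N : nat, 2 <= N.+1%:R * r.
  by exists (Num.truncn (2 / r)); rewrite -ler_pdivrMr // ltW // truncnS_gt.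
exists N.+1 => f /(fock_finE alpha0)[ef].
have : (0 <= \int[area]_w (weighted alpha f (Complex w.1 w.2) `^ r)%:E)%E.
  by apply: integral_ge0 => w _; rewrite lee_fin powR_ge0.
case E : (integral _ _ _) => [I0| |] // + _; rewrite lee_fin => I00.
pose eta : R := (2 * (32 * 2 ^+ N.+1))^-1.
have eta0 : 0 < eta by rewrite invr_gt0 !mulr_gt0 ?exprn_gt0.
pose C1 := (I0 / eta ^+ 2) `^ (r^-1).
exists (4 * C1 * expR (alpha / 2 * 3)).
  by rewrite !mulr_ge0 ?powR_ge0 ?expR_ge0.
move=> z; have z1 : 0 < 1 + cmod z by rewrite ltr_pwDl ?cmod_ge0.
have [->|fz] := eqVneq (f z) 0.
  rewrite cmod0; apply: mulr_ge0; last exact: expR_ge0.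
  apply: mulr_ge0; last by rewrite exprn_ge0 // ltW.
  by rewrite !mulr_ge0 ?powR_ge0 ?expR_ge0.
pose d := (1 + cmod z)^-1; have d0 : 0 < d by rewrite invr_gt0.
have dz : d * (1 + cmod z) = 1 by rewrite mulVf // gt_eqF.
have [z0 [rho [zr rho0 Hf Hh]]] := near_extremal N ef d0 fz.
have rho1 : rho <= 1.
  have := cmod_ge0 (z0 - z); have := cmod_ge0 z; nra.
pose G := expR (- (alpha / 2 * (cmod z ^+ 2 + 3))).
pose A := cmod (f z0) / 2 * G.
have A0 : 0 <= A by rewrite mulr_ge0 ?expR_ge0 // divr_ge0 ?cmod_ge0.
pose e := rho * eta; have e0 : 0 < e by rewrite mulr_gt0.
have low (w : R * R) : square z0 e w -> A `^ r <= weighted alpha f (Complex w.1 w.2) `^ r.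
  move=> /square_dist; set u := Complex _ _; rewrite (_ : 2 * e = rho / (32 * 2 ^+ N.+1)); last first.
    by rewrite /e /eta; field; rewrite expf_neq0.
  move=> hu; have hu' : cmod (u - z0) <= rho.
    apply: le_trans hu _; rewrite ler_pdivrMr ?mulr_gt0 ?exprn_gt0 // ler_peMr ?(ltW rho0) //.
    have : 1 <= 2 ^+ N.+1 :> R by rewrite exprn_ege1 // ler1n.
    lra.
  apply: ge0_ler_powR; rewrite ?nnegrE ?weighted_ge0 ?(ltW r0) //.
  have := Hh _ hu; rewrite (addrC z0) subrK => hfu.
  rewrite /A /weighted; apply: ler_pM; rewrite ?expR_ge0 ?divr_ge0 ?cmod_ge0 //.
  rewrite ler_expR mulNr lerN2 ler_wpM2l ?divr_ge0 ?(ltW alpha0) //.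
  have uz : cmod u <= cmod z + d.
    have -> : u = z + ((z0 - z) + (u - z0)) by ring.
    apply: le_trans (cmodD _ _) _; rewrite lerD2l; apply: le_trans (cmodD _ _) _.
    by apply: le_trans zr; rewrite lerD2l.
  apply: (@le_trans _ _ ((cmod z + d) ^+ 2)); first by apply: lerX; rewrite ?cmod_ge0.
  have := cmod_ge0 z; move: (cmod z) dz d0 {zr hu hu' hfu uz}; clear => x dz d0 x0.
  have d1 : d <= 1 by nra.
  have dx : d * x <= 1 by nra.
  rewrite (_ : (x + d) ^+ 2 = x ^+ 2 + 2 * (d * x) + d * d); last by ring.
  have dd : d * d <= 1 by rewrite mulr_ile1 // ltW.
  lra.
have := @integral_square_le f z0 e r (A `^ r) ef (ltW e0) (powR_ge0 _ _) low.
rewrite E lee_fin => Hint.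
have HA : A * rho ^+ N.+1 <= C1.
  have x0 : 0 <= A * rho ^+ N.+1 by rewrite mulr_ge0 // exprn_ge0 // ltW.
  have -> : A * rho ^+ N.+1 = ((A * rho ^+ N.+1) `^ r) `^ (r^-1).
    by rewrite -powRrM divff ?powRr1 // gt_eqF.
  apply: ge0_ler_powR; rewrite ?nnegrE ?powR_ge0 ?invr_ge0 ?(ltW r0) //.
    by rewrite divr_ge0 // exprn_ge0 // ltW.
  rewrite powRM ?exprn_ge0 ?(ltW rho0) // -powR_mulrn ?(ltW rho0) // -powRrM.
  rewrite ler_pdivlMr ?exprn_gt0 //; apply: le_trans Hint.
  rewrite /e exprMn [X in _ <= X]mulrA; apply: ler_wpM2r; first by rewrite exprn_ge0 // ltW.
  apply: ler_wpM2l; first exact: powR_ge0.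
  rewrite -(powR_mulrn 2 (ltW rho0)); apply: ger_powR => //.
  by rewrite rho0.
have G0 : 0 < G by exact: expR_gt0.
have fin1 : cmod (f z) * d ^+ N.+1 * G <= 4 * C1.
  apply: (@le_trans _ _ (4 * (A * rho ^+ N.+1))); last by rewrite ler_wpM2l.
  have -> : 4 * (A * rho ^+ N.+1) = 2 * (cmod (f z0) * rho ^+ N.+1) * G by rewrite /A; field.
  by rewrite ler_wpM2r // ltW.
have -> : cmod (f z) = cmod (f z) * d ^+ N.+1 * G * ((1 + cmod z) ^+ N.+1 * G^-1).
  have : d ^+ N.+1 * (1 + cmod z) ^+ N.+1 = 1 by rewrite -exprMn dz expr1n.
  have := lt0r_neq0 G0; move: (G) (d ^+ _) ((1 + _) ^+ _) => g u v g0 uv.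
  have -> : cmod (f z) * u * g * (v / g) = cmod (f z) * (u * v) by field.
  by rewrite uv mulr1.
rewrite (_ : 4 * C1 * _ * _ * _ = 4 * C1 * ((1 + cmod z) ^+ N.+1 * G^-1)); last first.
  have -> : G^-1 = expR (alpha / 2 * cmod z ^+ 2) * expR (alpha / 2 * 3).
    by rewrite /G expRN invrK (mulrDr (alpha / 2)) expRD.
  by ring.
apply: ler_wpM2r; last exact: fin1.
by apply: mulr_ge0; [rewrite exprn_ge0 // ltW|rewrite invr_ge0 ltW].
Qed.

End PointwiseBound.

(** * Dimensions of vanishing spaces *)

Section Dimension.
Variable R : realType.
Local Notation C := (R[i]).
Variables (alpha : R) (p : \bar R).
Hypotheses (alpha0 : 0 < alpha) (p0 : (0 < p)%E).
Implicit Types (f g q P : C -> C) (z w : C).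
Local Open Scope card_scope.

Lemma poly_lower (u : {poly C}) : u != 0 -> exists2 r0 : R, 1 <= r0 &
  exists2 c : R, 0 < c & forall z, r0 <= cmod z -> c * cmod z ^+ (size u).-1 <= cmod u.[z].
Proof.
move=> u0; set d := (size u).-1; have sd : size u = d.+1 by rewrite prednK // size_poly_gt0.
pose l := cmod (lead_coef u); have l0 : 0 < l by rewrite cmod_gt0 lead_coef_eq0.
pose S : R := \sum_(i < d) cmod u`_i; have S0 : 0 <= S by apply: sumr_ge0 => i _; exact: cmod_ge0.
exists (1 + 2 * S / l); first by rewrite lerDl divr_ge0 ?mulr_ge0 // ltW.
exists (l / 2); first by rewrite divr_gt0.
move=> z zr; have z1 : 1 <= cmod z.
  by apply: le_trans zr; rewrite lerDl divr_ge0 ?mulr_ge0 // ltW.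
have z0 : 0 < cmod z := lt_le_trans ltr01 z1.
have zS : S <= l / 2 * cmod z.
  have : 2 * S / l <= cmod z by move: zr; lra.
  rewrite ler_pdivrMr // => h; lra.
rewrite horner_coef sd big_ord_recr /= -/d.
have -> : u`_d = lead_coef u by rewrite /lead_coef.
have lowd : cmod (\sum_(i < d) u`_i * z ^+ i) <= l / 2 * cmod z ^+ d.
  apply: le_trans (cmod_sum _ _ _) _; case: (posnP d) => [dz|dp].
    rewrite big1; first by rewrite mulr_ge0 ?exprn_ge0 ?cmod_ge0 // divr_ge0 // ltW.
    by move=> i; have := ltn_ord i; rewrite [X in (_ < X)%N]dz.
  apply: (@le_trans _ _ (S * cmod z ^+ d.-1)).
    rewrite /S mulr_suml; apply: ler_sum => i _; rewrite cmodM cmodX.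
    by apply: ler_wpM2l; [exact: cmod_ge0|apply: ler_weXn2l => //; rewrite -ltnS prednK].
  rewrite -[X in _ <= _ * _ ^+ X](prednK dp) exprS mulrA.
  by apply: ler_wpM2r; [rewrite exprn_ge0 ?cmod_ge0|].
have := cmod_subl (lead_coef u * z ^+ d) (- \sum_(i < d) u`_i * z ^+ i).
rewrite opprK cmodN cmodM cmodX -/l (addrC (lead_coef u * _)) => /(le_trans _); apply.
lra.
Qed.

Lemma poly_fun0 n (c : 'I_n -> C) :
  (forall B : R, exists2 z : C, B <= cmod z & \sum_(i < n) c i * z ^+ i = 0) -> forall i, c i = 0.
Proof.
move=> H i; pose u : {poly C} := rVpoly (\row_j c j).
have hu z : u.[z] = \sum_(i < n) c i * z ^+ i.
  rewrite (@horner_coef_wide _ n) ?size_poly //; apply: eq_bigr => j _.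
  by rewrite coef_rVpoly_ord mxE.
have ci : u`_i = c i by rewrite coef_rVpoly_ord mxE.
have [u0|u0] := eqVneq u 0; first by rewrite -ci u0 coef0.
have [r0 r1 [c0 c00 Hl]] := poly_lower u0; have [z zr] := H r0.
rewrite -hu => uz; have := Hl z zr; rewrite uz cmod0 leNgt.
by rewrite mulr_gt0 // exprn_gt0 // (lt_le_trans ltr01) // (le_trans r1).
Qed.

Lemma decay_exponent : exists s : nat, forall r, p = r%:E -> 2 <= s%:R * r.
Proof.
have [[r r0 ->]|->] := pos_erealP p0; last by exists 0%N.
exists (Num.truncn (2 / r)).+1 => _ [<-]; rewrite -ler_pdivrMr // ltW // truncnS_gt //.
Qed.

(** From [1 + u <= exp u] with [u = c t / m], raised to the power [m]. *)
Lemma pow_le_gauss m : exists2 K : R, 0 <= K & forall z,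
  (1 + cmod z ^+ 2) ^+ m <= K * expR (alpha / 2 * cmod z ^+ 2).
Proof.
case: m => [|m].
  exists 1 => // z; rewrite expr0 mul1r -expR0 ler_expR mulr_ge0 ?sqr_ge0 //.
  by rewrite divr_ge0 // ltW.
have a2 : 0 < alpha / 2 by rewrite divr_gt0.
have k0 : 0 < m.+1%:R / (alpha / 2) by rewrite divr_gt0 ?ltr0n.
exists ((m.+1%:R / (alpha / 2)) ^+ m.+1 * expR (alpha / 2)).
  by rewrite mulr_ge0 ?expR_ge0 // exprn_ge0 // ltW.
move=> z.
have -> : forall X, X * expR (alpha / 2) * expR (alpha / 2 * cmod z ^+ 2) =
    X * expR (alpha / 2 * (1 + cmod z ^+ 2)).
  by move=> X; rewrite mulrDr mulr1 expRD mulrA.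
set t := 1 + cmod z ^+ 2; have t0 : 0 <= t by rewrite addr_ge0 ?sqr_ge0.
have -> : alpha / 2 * t = m.+1%:R * (t / (m.+1%:R / (alpha / 2))).
  by field; rewrite !gt_eqF ?ltr0n.
rewrite expRM_natl -exprMn; apply: lerX => //.
rewrite mulrC -ler_pdivrMr //; apply: le_trans (expR_ge1Dx _); by rewrite lerDr.
Qed.

Lemma entireX n : entire (fun z : C => z ^+ n).
Proof. by apply/entireP => z; apply: cdiffX; exact: cdiff_id. Qed.

Lemma entireM f g : entire f -> entire g -> entire (fun z => f z * g z).
Proof. by move=> /entireP df /entireP dg; apply/entireP => z; exact: cdiffM. Qed.

Lemma fock_monomial j : fock_space p alpha (fun z => z ^+ j).
Proof.
have [s Hs] := decay_exponent; have [K K0 HK] := pow_le_gauss (j + s).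
apply: (@fock_of_decay R alpha alpha0 p _ s K p0 (@entireX j) Hs) => z.
apply: le_trans (HK z); rewrite exprD cmodX; apply: ler_wpM2r.
  by rewrite exprn_ge0 // addr_ge0 // sqr_ge0.
by apply: lerX; [exact: cmod_ge0|have := cmod_ge0 z; nra].
Qed.

(** The [n + 1] monomials [1, ..., z^n] lie in the space and would be combinations
of [n] functions, hence linearly dependent. *)
Theorem fock_infinite_dim n : ~ has_basis (fock_space p alpha) n.
Proof.
move=> [b [_ _ sp]].
have Hc (j : 'I_n.+1) : exists c : 'I_n -> C, forall z, z ^+ j = \sum_(i < n) c i * b i z.
  exact: sp (fock_monomial j).
have [c cE] := choice Hc.
pose A : 'M[C]_(n.+1, n) := \matrix_(j, i) c j i.
pose u := nz_row (kermx A).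
have uA : u *m A = 0 by apply/sub_kermxP; exact: nz_row_sub.
have u0 : u != 0.
  by rewrite nz_row_eq0 -mxrank_eq0 mxrank_ker subn_eq0 -ltnNge ltnS rank_leq_col.
move/eqP: u0; apply; apply/rowP => j; rewrite [RHS]mxE.
apply: (@poly_fun0 _ (fun j => u 0 j)) => B.
exists ((`|B|)%:C%C); first by rewrite cmod_real normr_id ler_norm.
set z := _%:C%C.
rewrite (eq_bigr (fun j => \sum_i u 0 j * A j i * b i z)); last first.
  by move=> k _; rewrite cE mulr_sumr; apply: eq_bigr => i _; rewrite mxE mulrA.
rewrite exchange_big /= big1 // => i _; rewrite -mulr_suml.
by have /matrixP/(_ 0 i) := uA; rewrite !mxE => ->; rewrite mul0r.
Qed.

(** [P] is a function whose size relative to the Gaussian weight is at most of order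
[|z|^(-2 M)] everywhere, and at least of order [|z|^(-2 M - 2)] on arbitrarily
large circles. *)
Section Finite.
Variables (k M : nat) (P : C -> C).
Hypotheses (k0 : (0 < k)%N) (eP : entire P)
  (Hup : forall z, cmod z ^+ (2 * M) * cmod (P z) <= 2 * expR (alpha / 2 * cmod z ^+ 2))
  (Hlow : forall B : R, exists2 r : R, B < r & forall z, cmod z = r ->
    expR (alpha / 2 * r ^+ 2) <= alpha * r ^+ (2 * M).+2 * cmod (P z)).

Let Q j := fun z => z ^+ j * P z.

Lemma entire_Q j : entire (Q j).
Proof. exact: (entireM (@entireX j) eP). Qed.

Lemma low_neq0 r z : 0 < r -> cmod z = r ->
  expR (alpha / 2 * r ^+ 2) <= alpha * r ^+ (2 * M).+2 * cmod (P z) -> P z != 0.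
Proof.
move=> r0 zr; apply: contraTneq => ->; rewrite cmod0 mulr0 -ltNge; exact: expR_gt0.
Qed.

Lemma fock_small_power j s : (forall r, p = r%:E -> 2 <= s%:R * r) -> (j + 2 * s <= 2 * M)%N ->
  fock_space p alpha (Q j).
Proof.
move=> Hs js; have [K K0 HK] := entire_bounded eP ler01.
apply: (@fock_of_decay R alpha alpha0 p _ s (2 ^+ s * (2 + K)) p0 (@entire_Q j) Hs) => z.
have z0 := cmod_ge0 z; have P0 := cmod_ge0 (P z).
have e1 : 1 <= expR (alpha / 2 * cmod z ^+ 2).
  by rewrite -expR0 ler_expR mulr_ge0 ?sqr_ge0 // divr_ge0 // ltW.
have s0 : 0 <= 2 ^+ s :> R by rewrite exprn_ge0.
rewrite cmodM cmodX; have [z1|z1] := leP (cmod z) 1.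
  apply: (@le_trans _ _ (K * 2 ^+ s)).
    apply: ler_pM; rewrite ?mulr_ge0 ?exprn_ge0 ?addr_ge0 ?sqr_ge0 //.
      rewrite -[K]mul1r; apply: ler_pM; rewrite ?exprn_ge0 ?HK //.
      by rewrite exprn_ile1.
    apply: lerX; first by rewrite addr_ge0 ?sqr_ge0.
    by rewrite -[2]/(1 + 1) lerD2l exprn_ile1.
  have h0 : 0 <= K * 2 ^+ s by rewrite mulr_ge0.
  apply: (@le_trans _ _ (2 ^+ s * (2 + K))).
    by rewrite mulrC; apply: ler_wpM2l => //; rewrite lerDr.
  by rewrite ler_peMr // mulr_ge0 // addr_ge0.
apply: (@le_trans _ _ (2 ^+ s * (cmod z ^+ (2 * M) * cmod (P z)))); last first.
  rewrite -[X in _ <= X]mulrA; apply: ler_wpM2l => //; apply: le_trans (Hup z) _.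
  by apply: ler_wpM2r; [exact: expR_ge0|rewrite lerDl].
apply: (@le_trans _ _ (cmod z ^+ j * cmod (P z) * (2 * cmod z ^+ 2) ^+ s)).
  apply: ler_wpM2l; first by rewrite mulr_ge0 ?exprn_ge0.
  apply: lerX; first by rewrite addr_ge0 ?sqr_ge0.
  by rewrite mulr_natl mulr2n lerD2r exprn_ege1 // ltW.
rewrite exprMn -exprM (_ : _ * _ * _ = 2 ^+ s * (cmod z ^+ (j + 2 * s) * cmod (P z))); last first.
  by rewrite exprD; ring.
apply: ler_wpM2l => //; apply: ler_wpM2r => //.
by apply: ler_weXn2l => //; exact: ltW.
Qed.

(** On the circles where [P] is large, every [f] in the space is at most
polynomially larger than [P]; the degree does not depend on [f]. *)
Lemma fock_le_on_circles : exists N : nat, forall f, fock_space p alpha f -> exists2 K : R, 0 <= K &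
  forall B : R, exists2 r : R, Num.max 1 B < r & forall z, cmod z = r ->
    P z != 0 /\ cmod (f z) <= K * r ^+ N * cmod (P z).
Proof.
have [n Hn] := fock_pointwise alpha0 p0.
exists (n + (2 * M).+2)%N => f /Hn[K K0 HK].
exists (K * 2 ^+ n * alpha); first by rewrite !mulr_ge0 ?exprn_ge0 // ltW.
move=> B; have [r rB Hr] := Hlow (Num.max 1 B).
have r1 : 1 < r by apply: le_lt_trans rB; rewrite le_max lexx.
have r0 : 0 < r := lt_trans ltr01 r1.
exists r => // z zr; split; first exact: low_neq0 r0 zr (Hr z zr).
apply: le_trans (HK z) _; rewrite zr.
apply: (@le_trans _ _ (K * (2 * r) ^+ n * (alpha * r ^+ (2 * M).+2 * cmod (P z)))).
  apply: ler_pM; rewrite ?expR_ge0 ?Hr //.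
    by rewrite mulr_ge0 // exprn_ge0 // addr_ge0 // ltW.
  apply: ler_wpM2l => //; apply: lerX; first by rewrite addr_ge0 // ltW.
  by rewrite mulr_natl mulr2n lerD2r ltW.
by rewrite exprMn exprD le_eqVlt; apply/orP; left; apply/eqP; ring.
Qed.

Lemma not_fock_large_power : exists j, ~ fock_space p alpha (Q j).
Proof.
have [N HN] := fock_le_on_circles; exists N.+1 => /HN[K K0 HK].
have [r rB Hr] := HK K; have rK : K < r by apply: le_lt_trans rB; rewrite le_max lexx orbT.
have r0 : 0 < r by apply: le_lt_trans rK.
have zr : cmod (r%:C%C) = r by rewrite cmod_real gtr0_norm.
have [Pz] := Hr _ zr; rewrite cmodM cmodX zr ler_pM2r ?cmod_gt0 // exprS.
by rewrite ler_pM2r ?exprn_gt0 // leNgt rK.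
Qed.

(** Let [J] be the first power with [z^J P] outside the space and [a = J - k].  A
function that vanishes on the zeros of [z^a P] is [q z^a P] with [q] entire, and
[q] is a polynomial because it grows polynomially on the good circles.  Its
degree is below [k], for otherwise [z^J P] would be dominated by [|f| + |P|]. *)
Theorem finite_dim s : (forall r, p = r%:E -> 2 <= s%:R * r) -> (k + 2 * s <= 2 * M)%N ->
  exists Z : point_seq R, zero_sequence p alpha Z /\ has_basis (vanishing_space p alpha Z) k.
Proof.
move=> Hs ks; have exj : exists j, `[< ~ fock_space p alpha (Q j) >].
  by have [j Hj] := not_fock_large_power; exists j; apply/asboolP.
case: (ex_minnP exj) => J /asboolP HJ minJ {exj}.
have FQ j : (j < J)%N -> fock_space p alpha (Q j).
  by move=> jJ; apply: contrapT => /asboolP/minJ; rewrite leqNgt jJ.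
have kJ : (k <= J)%N.
  rewrite leqNgt; apply/negP => Jk; apply: HJ; apply: (@fock_small_power J s Hs).
  by apply: leq_trans ks; rewrite leq_add2r ltnW.
pose a := (J - k)%N; have aJ : (a < J)%N by rewrite ltn_subrL k0 (leq_trans k0).
have ak : (a + k = J)%N by rewrite subnK.
have F0 : exists z, Q a z != 0.
  have [r rB Hr] := Hlow 1; have r0 : 0 < r := lt_trans ltr01 rB.
  have zr : cmod (r%:C%C) = r by rewrite cmod_real gtr0_norm.
  exists (r%:C%C); rewrite mulf_neq0 ?(low_neq0 r0 zr (Hr _ zr)) //.
  by rewrite expf_neq0 // -cmod_gt0 zr.
have [Z HZ] := zeros_exactly_exists (@entire_Q a) F0.
exists Z; split; first by exists (Q a); split; [exact: (FQ a aJ)|exact: F0|exact: HZ].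
exists (fun i : 'I_k => Q (a + i)%N); split.
- move=> i; split; first by apply: FQ; rewrite -ak ltn_add2l.
  move=> c m mZ; have [m' occ' [g [eg gc FE]]] := HZ c.
  move: occ'; rewrite card_eq_le => /andP[occ' _].
  have mm : (m <= m')%N by rewrite -card_le_II (card_le_trans mZ occ').
  exists (fun z => z ^+ i * (z - c) ^+ (m' - m) * g z).
    have eX : entire (fun z => (z - c) ^+ (m' - m)).
      apply/entireP => z; apply: cdiffX.
      by apply: cdiffB; [exact: cdiff_id|exact: cdiff_cst].
    exact: (entireM (entireM (@entireX i) eX) eg).
  move=> z; rewrite /Q exprD mulrAC -[z ^+ a * P z]/(Q a z) FE -{1}(subnKC mm) exprD.
  ring.
- move=> c Hc; apply: poly_fun0 => B.
  have [r rB Hr] := Hlow (Num.max 1 B).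
  have r1 : 1 < r by apply: le_lt_trans rB; rewrite le_max lexx.
  have r0 : 0 < r := lt_trans ltr01 r1.
  have zr : cmod (r%:C%C) = r by rewrite cmod_real gtr0_norm.
  exists (r%:C%C); first by rewrite zr; apply/ltW/(le_lt_trans _ rB); rewrite le_max lexx orbT.
  have Qz : Q a (r%:C%C) != 0.
    rewrite mulf_neq0 ?(low_neq0 r0 zr (Hr _ zr)) //.
    by rewrite expf_neq0 // -cmod_gt0 zr.
  apply: (mulIf Qz); rewrite mul0r -[RHS](Hc (r%:C%C)) mulr_suml.
  by apply: eq_bigr => i _; rewrite /Q exprD; ring.
move=> f [Ff Vf].
have [q eq_ fE] : exists2 q : C -> C, entire q & forall z, f z = q z * Q a z.
  apply: entire_quotient; [exact: fock_entire Ff|exact: entire_Q|].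
  move=> c; have [m occm zo] := HZ c; exists m => //.
  by move: occm; rewrite card_eq_le => /andP[_ occm]; exact: (Vf c m occm).
have [N HN] := fock_le_on_circles; have [K K0 HK] := HN f Ff.
have [u qu] : exists u : {poly C}, forall z, q z = u.[z].
  apply: (@entire_poly R q N K eq_) => B; have [r rB Hr] := HK B.
  have r1 : 1 < r by apply: le_lt_trans rB; rewrite le_max lexx.
  have r0 : 0 < r := lt_trans ltr01 r1.
  exists r; first by apply: le_lt_trans rB; rewrite le_max lexx orbT.
  move=> z zr; have [Pz] := Hr z zr; rewrite fE /Q !cmodM cmodX zr mulrA.
  rewrite ler_pM2r ?cmod_gt0 //; apply: le_trans.
  by rewrite ler_peMr ?cmod_ge0 // exprn_ege1 // ltW.
have su : (size u <= k)%N.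
  rewrite leqNgt; apply/negP => ku; apply: HJ.
  have u0 : u != 0 by rewrite -size_poly_gt0 (leq_trans _ ku).
  have [r0 r1 [c c0 Hl]] := poly_lower u0.
  have FP : fock_space p alpha P.
    have := FQ 0%N (leq_trans k0 kJ); congr (fock_space _ _ _).
    by apply/funext => z; rewrite /Q expr0 mul1r.
  have D0 : 0 <= c^-1 + r0 ^+ J.
    by rewrite addr_ge0 ?invr_ge0 ?exprn_ge0 ?(ltW c0) // (le_trans ler01).
  apply: (fock_dominated alpha0 p0 D0 Ff FP (@entire_Q J)) => z.
  rewrite mulrDr; have z0 := cmod_ge0 z; have P0 := cmod_ge0 (P z); have f0 := cmod_ge0 (f z).
  rewrite {1}/Q cmodM cmodX; have [zr|zr] := leP (cmod z) r0.
    apply: (@le_trans _ _ (r0 ^+ J * cmod (P z))).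
      by apply: ler_wpM2r => //; exact: lerX.
    rewrite -[X in X <= _]add0r; apply: lerD; first exact: mulr_ge0.
    by apply: ler_wpM2r => //; rewrite lerDr invr_ge0 ltW.
  have z1 : 1 <= cmod z := le_trans r1 (ltW zr).
  apply: (@le_trans _ _ (c^-1 * cmod (f z))); last first.
    rewrite -[X in X <= _]addr0; apply: lerD; last exact: mulr_ge0.
    by apply: ler_wpM2r => //; rewrite lerDl exprn_ge0 // (le_trans ler01).
  rewrite ler_pdivlMl // fE /Q !cmodM cmodX !mulrA; apply: ler_wpM2r => //.
  rewrite -ak (addnC a) exprD mulrA; apply: ler_wpM2r; first exact: exprn_ge0.
  rewrite qu; apply: le_trans (Hl z (ltW zr)); apply: ler_wpM2l; first exact: ltW.
  by apply: ler_weXn2l => //; rewrite -ltnS prednK // (leq_trans _ ku).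
exists (fun i : 'I_k => u`_i) => z; rewrite fE qu (horner_coef_wide _ su) mulr_suml.
by apply: eq_bigr => i _; rewrite /Q exprD; ring.
Qed.

End Finite.

End Dimension.

Theorem theorem4 (R : realType) (alpha : R) (p : \bar R) (k : option nat)
    (halpha : 0 < alpha) (hp : (0 < p)%E)
    (hk : forall n : nat, k = Some n -> (0 < n)%N) :
  exists Z : point_seq R,
    zero_sequence p alpha Z /\ dim_is (vanishing_space p alpha Z) k.
Proof.
case: k hk => [k|] hk.
  have [s Hs] := decay_exponent hp.
  have [P [eP Hup Hlow]] := lacunary_exists (s + k) halpha.
  apply: (finite_dim halpha hp (hk k erefl) eP Hup Hlow Hs); lia.
have F1 : fock_space p alpha (fun=> 1) := fock_monomial halpha hp 0.
have e1 : entire (fun=> 1 : R[i]) := fock_entire F1.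
exists (fun=> None); split.
  exists (fun=> 1); split; [exact: F1|by exists 0; exact: oner_neq0|].
  move=> a; exists 0%N; last first.
    by exists (fun=> 1); split=> [||z]; [exact: e1|exact: oner_neq0|rewrite expr0 mul1r].
  by rewrite II0 card_eq0; apply/eqP/seteqP; split=> n.
suff -> : vanishing_space p alpha (fun=> None) = fock_space p alpha by exact: fock_infinite_dim.
apply/seteqP; split=> f; first by case.
move=> Ff; split; first exact: Ff.
move=> a m mZ; have : (`I_m #<= `I_0)%card.
  by apply: card_le_trans mZ _; rewrite II0; apply: subset_card_le => n.
rewrite card_le_II leqn0 => /eqP ->.
by exists f => [|z]; [exact: fock_entire Ff|rewrite expr0 mul1r].
Qed.
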